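(* Let $k\in\mathbb{N}$, let $h:\mathbf{S}_k(\mathbb{X})\to\{0,1\}$ be measurable, and for $\xi\in\mathbf{S}(\mathbb{X})$ set $$F(\xi)=\sum_{\psi\subset\xi:\,|\psi|=k}h(\psi).$$ Let $s>0$, and let $\eta$ be a Poisson process on $\mathbb{X}$ with mean measure $\lambda:=s\mu$. Let $\alpha=\mathbb{E}\,F(\eta)$ and $$\gamma(h,\lambda):=\sum_{\ell=1}^{k-1}\frac{k!}{\ell!\,((k-\ell)!)^2}\int_{\mathbb{X}^\ell}\left(\int_{\mathbb{X}^{k-\ell}}h(\{x_1,\ldots,x_\ell,y_1,\ldots,y_{k-\ell}\})\,\lambda^{k-\ell}(d(y_1,\ldots,y_{k-\ell}))\right)^2\lambda^\ell(d(x_1,\ldots,x_\ell)).$$ Then $$d_{TV}(\mathcal{L}(F(\eta)),\mathcal{L}(Z_\alpha))\leq (1\wedge\alpha^{-1})\,\frac{\gamma(h,\lambda)}{k!}$$ and $$d_{W}(\mathcal{L}(F(\eta)),\mathcal{L}(Z_\alpha))\leq 3(1\wedge\alpha^{-1/2})\,\frac{\gamma(h,\lambda)}{k!}.$$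
   Context: $(\mathbb{X},\mathcal{F},\mu)$ is a probability space with $\mu$ diffuse, meaning that there is a product-measurable set $A\subset\mathbb{X}\times\mathbb{X}$ with $(\mu\otimes\mu)(A)=0$ that contains the diagonal $\{(x,x):x\in\mathbb{X}\}$. $\mathbf{S}(\mathbb{X})$ is the space of all finite subsets of $\mathbb{X}$, equipped with the smallest $\sigma$-algebra containing the sets $\{\xi: |\xi\cap B|=m\}$ for all $B\in\mathcal{F}$ and $m\in\mathbb{N}_0$, where $|\cdot|$ is the number of elements; $\mathbf{S}_k(\mathbb{X}):=\{\xi\in\mathbf{S}(\mathbb{X}):|\xi|=k\}$ (with the trace $\sigma$-algebra). The value of the integrand in $\gamma(h,\lambda)$ when the points $x_1,\ldots,x_\ell,y_1,\ldots,y_{k-\ell}$ are not all distinct is irrelevant, since such tuples are contained in a null set. The Poisson process $\eta$ is realized as $\{X_1,\ldots,X_N\}$ with $X_1,X_2,\ldots$ independent with distribution $\mu$ and $N$ an independent Poisson random variable with mean $s$. $\mathcal{L}(\cdot)$ denotes the law of a random variable. $Z_\alpha$ is a Poisson random variable with parameter $\alpha$. $a\wedge b=\min(a,b)$. In the degenerate case $\alpha=0$, $Z_0:=0$ and $1\wedge 0^{-1}=1\wedge 0^{-1/2}:=1$. For $\mathbb{N}_0$-valued random variables $X,Y$, $$d_{TV}(\mathcal{L}(X),\mathcal{L}(Y)) = \sup_{A\subset\mathbb{N}_0}(\mathbb{P}[X\in A]-\mathbb{P}[Y\in A]),$$ $$d_W(\mathcal{L}(X),\mathcal{L}(Y)) =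 \sup\{|\mathbb{E}g(X)-\mathbb{E}g(Y)| : g:\mathbb{N}_0\to\mathbb{R},\ \sup_{i\in\mathbb{N}_0}|g(i+1)-g(i)|\le 1\}.$$ *)

(* Defs.v *)
From HB Require Import structures.
From mathcomp Require Import all_boot all_order all_algebra finmap.
From mathcomp Require Import all_classical all_reals all_analysis.

Set Implicit Arguments.
Unset Strict Implicit.
Unset Printing Implicit Defensive.

Import Order.TTheory GRing.Theory Num.Theory.

Local Open Scope classical_set_scope.
Local Open Scope ring_scope.

(* A measurable space is a pointed choiceType, so the finite subsets of T are
   the elements of {fset T}. *)
Section finite_configurations.
Context d (T : measurableType d).
Local Open Scope fset_scope.

Definition count_in (xi : {fset T}) (B : set T) : nat :=
  #|` [fset x in xi | x \in B] |.

Definition count_events : set (set {fset T}) :=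
  [set E | exists B m, measurable B /\
                       E = [set xi : {fset T} | count_in xi B = m]]%classic.

Definition config := g_sigma_algebraType count_events.

Definition config_card (k : nat) : set config :=
  [set xi : config | #|` (xi : {fset T}) | = k]%classic.

Lemma measurable_config_card k : measurable (config_card k).
Proof.
apply: sub_sigma_algebra; exists setT, k; split; first exact: measurableT.
apply/seteqP; split=> xi; rewrite /config_card /count_in /= => <-.
  congr (#|` _|); apply/fsetP => x.
  by rewrite !inE /= mem_setT andbT.
congr (#|` _|); apply/fsetP => x.
by rewrite !inE /= mem_setT andbT.
Qed.

(* Only the values of h on config_card k are used here and in on_points, so a
   function on the k-point configurations is represented by a total h; it is
   measurable for the trace sigma-algebra iff
   measurable_fun (config_card k) h. *)
Definition subset_count (k : nat) (h : config -> bool) (xi : config) : nat :=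
  (\sum_(psi <- fpowerset (xi : {fset T}) | #|` psi| == k) h psi)%N.

(* h({x_1, ..., x_k}) for a k-tuple of points that are all distinct, and 0 for
   the other k-tuples (which form a subset of a null set when the underlying
   measure is diffuse). *)
Definition on_points (k : nat) (h : config -> bool) (s : seq T) : bool :=
  (#|` [fset x in s] | == k) && h [fset x in s].

End finite_configurations.

Section product_power.
Context d (T : measurableType d) (R : realType).
Variable m : {finite_measure set T -> \bar R}.

Section step.
Variables (n : nat) (p : {finite_measure set (n.-tuple T) -> \bar R}).

Definition consp (xt : T * n.-tuple T) : n.+1.-tuple T :=
  [tuple of xt.1 :: xt.2].

Lemma measurable_consp : measurable_fun setT consp.
Proof. exact: measurable_cons. Qed.

Definition power_step : set (n.+1.-tuple T) -> \bar R :=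
  pushforward (m \x p)%E consp.

Let power_step0 : power_step set0 = 0%E.
Proof. by rewrite /power_step /pushforward preimage_set0 measure0. Qed.

Let power_step_ge0 A : (0 <= power_step A)%E.
Proof. exact: (measure_ge0 (m \x p)%E). Qed.

Let power_step_sigma_additive : semi_sigma_additive power_step.
Proof.
move=> F mF tF mUF; rewrite /power_step /pushforward preimage_bigcup.
have mpre A : measurable A -> measurable (consp @^-1` A).
  by move=> mA; rewrite -[X in measurable X]setTI; exact: measurable_consp.
apply: measure_semi_sigma_additive.
- by move=> n0; exact: mpre.
- apply/trivIsetP => /= i j _ _ ij; rewrite -preimage_setI.
  by move/trivIsetP : tF => /(_ _ _ _ _ ij) ->//; rewrite preimage_set0.
- by rewrite -preimage_bigcup; exact: mpre.
Qed.

HB.instance Definition _ := isMeasure.Build _ _ _ power_step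
  power_step0 power_step_ge0 power_step_sigma_additive.

Let power_step_fin : fin_num_fun power_step.
Proof.
apply: lty_fin_num_fun.
suff : ((m \x p)%E (setT `*` setT) < +oo)%E by rewrite setXTT.
rewrite product_measure1E//.
by rewrite lte_mul_pinfty// ?fin_num_fun_lty//; exact: fin_num_measure.
Qed.

HB.instance Definition _ := Measure_isFinite.Build _ _ _ power_step power_step_fin.

End step.

(* The n-fold product measure m^n on T^n. *)
Fixpoint power_measure n : {finite_measure set (n.-tuple T) -> \bar R} :=
  match n with
  | 0 => \d_[tuple] : {finite_measure set (0.-tuple T) -> \bar R}
  | n'.+1 => power_step (power_measure n')
  end.

Lemma power_measure_box n (B : 'I_n -> set T) :
  (forall i, measurable (B i)) ->
  power_measure n [set t | forall i, B i (tnth t i)] =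
  (\prod_(i < n) fine (m (B i)))%:E.
Proof.
elim: n B => [|n IHn] B mB.
  by rewrite big_ord0 /= diracE mem_set// => -[].
have mbox k (C : 'I_k -> set T) : (forall i, measurable (C i)) ->
    measurable [set t : k.-tuple T | forall i, C i (tnth t i)].
  move=> mC; rewrite [X in measurable X](_ : _ =
      \bigcap_(i in [set: 'I_k]) ((@tnth k T)^~ i @^-1` C i)); last first.
    by apply/seteqP; split=> [t tC i _|t tC i]; exact: tC.
  apply: fin_bigcap_measurable => [|i _]; first exact: finite_finset.
  rewrite -[X in measurable X]setTI.
  exact: (measurable_tnth i measurableT (mC i)).
rewrite big_ord_recl EFinM -(IHn (fun i => B (lift ord0 i)))//.
rewrite fineK ?fin_num_measure//.
rewrite -product_measure1E//; last by apply: (mbox _ (fun i => B (lift ord0 i))).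
rewrite /= /power_step /pushforward; congr (_ _).
apply/seteqP; split=> [[x t] /= xtB|[x t] /= [xB tB] i].
  split=> [|i]; first by have := xtB ord0; rewrite tnth0.
  by have := xtB (lift ord0 i); rewrite tnthS.
case: (unliftP ord0 i) => [j ->|->]; last by rewrite tnth0.
by rewrite tnthS.
Qed.

End product_power.

Definition diffuse d (T : measurableType d) (R : realType)
    (mu : set T -> \bar R) : Prop :=
  exists A : set (T * T),
    [/\ measurable A, (mu \x mu)%E A = 0%E & forall x, A (x, x)].

Section random_variables.
Context d (Omega : measurableType d) (R : realType) (P : probability Omega R).

(* Mutual independence of a family of sub-sigma-algebras. *)
Definition mutually_independent (I : choiceType)
    (G : I -> set (set Omega)) : Prop :=
  forall (J : {fset I}) (A : I -> set Omega),
    (forall i, i \in J -> G i (A i)) ->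
    P (\bigcap_(i in [set` J]) A i) = (\prod_(i <- J) fine (P (A i)))%:E.

(* The nat argument of poisson_prob is unused. At alpha = 0, poisson_prob is the
   Dirac measure at 0. *)
Definition poisson_rv (Z : Omega -> nat) (alpha : R) : Prop :=
  measurable_fun setT Z /\
  forall A : set nat, P (Z @^-1` A) = poisson_prob alpha 0 A.

(* eta = {X_1, ..., X_N} is only required almost surely: when two of the X_i
   coincide, {X_1, ..., X_N} has less than N points, and the event that this
   happens, although contained in a null event, need not be measurable if the
   diagonal of T * T is not. Hence {X_1, ..., X_N} itself need not be
   measurable, but it has measurable modifications. *)
Definition poisson_process d' (T : measurableType d') (s : R)
    (mu : probability T R) (eta : Omega -> config T) : Prop :=
  measurable_fun setT eta /\
  exists (X : nat -> {mfun Omega >-> T}) (N : {mfun Omega >-> nat}),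
    [/\ forall i A, measurable A -> P (X i @^-1` A) = mu A,
        poisson_rv N s,
        mutually_independent (fun o : option nat =>
          if o is Some i then g_sigma_algebra_preimage (X i)
          else g_sigma_algebra_preimage N) &
        {ae P, forall w, eta w = [fset X i w | i in iota 0 (N w)]%fset}].

End random_variables.

Section distances.
Context d1 (T1 : measurableType d1) d2 (T2 : measurableType d2) (R : realType).
Variables (P : probability T1 R) (X : T1 -> nat).
Variables (Q : probability T2 R) (Y : T2 -> nat).

Definition dTV : \bar R :=
  ereal_sup [set (P (X @^-1` A) - Q (Y @^-1` A))%E | A in [set: set nat]].

Definition dW : \bar R :=
  ereal_sup [set `| 'E_P[g \o X] - 'E_Q[g \o Y] |%E
            | g in [set g : nat -> R | forall i, `|g i.+1 - g i| <= 1]].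

End distances.

(* The inner integrand, hence also the outer one, may fail to be measurable on a
   null set; the integral of a nonnegative function, defined as a supremum over
   simple functions, then still has the value of the integral of any measurable
   function that is almost everywhere equal to it. *)
Definition gamma d (T : measurableType d) (R : realType) (k : nat)
    (h : config T -> bool) (lam : {finite_measure set T -> \bar R}) : \bar R :=
  (\sum_(1 <= l < k)
    (k`!%:R / (l`!%:R * (k - l)`!%:R ^+ 2))%:E *
    \int[power_measure lam l]_x
      (\int[power_measure lam (k - l)]_y (on_points k h (x ++ y))%:R%:E) ^+ 2)%E.

(* 1 /\ a^-1, with value 1 at a = 0 (where 0^-1 is 0 in the library). *)
Definition min1inv (R : realType) (a : R) : R :=
  if a == 0 then 1 else Num.min 1 a^-1.

(* Main.v *)
Require Import Defs.
From HB Require Import structures.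
From mathcomp Require Import all_boot all_order all_algebra finmap.
From mathcomp Require Import ring lra zify.
From mathcomp Require Import all_classical all_reals all_analysis.
From mathcomp Require Import measurable_realfun.

(* On the event that it has n points, a Poisson process with mean measure lam has
   the law exp(-lam(T))/n! lam^n; hence
     P(F(eta) in S) = sum_n exp(-lam(T))/n! lam^n(U in S),
   where U is the U-statistic of an n-tuple.  Exchangeability of lam^n then gives
   the Mecke formula
     D_j := E[F; F >= j] - alpha P(F + 1 >= j)
          = 1/k! int h(x) P(F(eta) + 1 < j <= F(eta + x)) lam^k(dx) >= 0,
   and summing over j counts the k-subsets of eta + x that meet x without being
   equal to x, so that sum_j D_j <= gamma / k!.

   On the other hand, for every g, with f the solution of the Stein equation
   alpha f(i+1) - i f(i) = g(i) - E g(Z), summation by parts yields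
     E g(F) - E g(Z) = - sum_j (f(j) - f(j-1)) D_j,
   and it remains to bound the increments of f.  To avoid infinite series, the
   equation is solved on {0, ..., M} with f constant from M on, E g(Z) being
   replaced by a constant c close to it; the errors vanish as M tends to
   infinity.  The bounds |f| <= 1 (g Lipschitz) and |f(i+1) - f(i)| <= 1 (g an
   indicator) are maximum principles for the equation differenced once and
   twice; the bounds in alpha^(-1/2) and alpha^(-1) come from inductions starting
   at 0 below alpha and at M above alpha. *)

Set Implicit Arguments.
Unset Strict Implicit.
Unset Printing Implicit Defensive.

Import Order.TTheory GRing.Theory Num.Theory.

(** * Sublists of a given length *)

(** Two obstacles shape the measure theory. The diagonal of [T * T] need not be measurable, so
    neither the map from a tuple to its set of points nor [on_points] need be measurable on tuples.
    Tuples meeting the null set given by diffuseness are therefore cut out, and the resulting kernel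
    is compared with [on_points] only by an inequality, which suffices for an upper bound. Moreover,
    subsets are replaced by sublists of positions: U-statistics then make sense on all tuples, and
    indices can be permuted freely. The truncated Stein solution is reflected at M: c is the mean of
    g under weights for which al f(i+1) - i f(i) has mean zero whenever f(M+1) = f(M). The same c
    serves both laws and cancels in their difference; what must be controlled is that c and f(M)
    stay bounded as M grows. The constant 3 arises where |i - al| <= sqrt al: there al times the
    increment of f at i is a sum of terms bounded by 3 sqrt al in total. Elsewhere 2 suffices. *)

Fixpoint subs (A : Type) (k : nat) (s : seq A) {struct s} : seq (seq A) :=
  match k, s with
  | 0, _ => [:: [::]]
  | _.+1, [::] => [::]
  | k'.+1, x :: s' => map (cons x) (subs k' s') ++ subs k s'
  end.

Section Subs.
Variable A : Type.
Implicit Types (s : seq A) (k : nat).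

Lemma subs0 s : subs 0 s = [:: [::]].
Proof. by case: s. Qed.

Lemma subsS k x s : subs k.+1 (x :: s) = map (cons x) (subs k s) ++ subs k.+1 s.
Proof. by []. Qed.

Lemma size_subs k s : size (subs k s) = 'C(size s, k).
Proof.
elim: s k => [|x s IHs] [|k]; rewrite ?subs0 ?bin0 ?bin0n//.
by rewrite subsS size_cat size_map !IHs /= binS addnC.
Qed.

(** Sublists are chosen by position, hence commute with every map, injective or not. This turns sums
    over sublists of a tuple into sums over lists of indices. *)
Lemma map_subs (B : Type) (f : A -> B) k s :
  subs k (map f s) = map (map f) (subs k s).
Proof.
elim: s k => [|x s IHs] [|k] //=.
by rewrite map_cat !IHs -!map_comp.
Qed.

Lemma subs_geq_nil k s : size s < k -> subs k s = [::].
Proof.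
by move=> sk; apply: size0nil; rewrite size_subs bin_small.
Qed.

Lemma big_subsS (phi : seq A -> nat) k x s :
  \sum_(t <- subs k.+1 (x :: s)) phi t =
  \sum_(t <- subs k s) phi (x :: t) + \sum_(t <- subs k.+1 s) phi t.
Proof. by rewrite subsS big_cat big_map. Qed.

(** A Vandermonde decomposition: [l] is the number of entries taken from [s1]. *)
Lemma big_subs_cat (phi : seq A -> nat) k s1 s2 :
  \sum_(t <- subs k (s1 ++ s2)) phi t =
  \sum_(0 <= l < k.+1) \sum_(t1 <- subs l s1) \sum_(t2 <- subs (k - l) s2)
    phi (t1 ++ t2).
Proof.
elim: s1 k phi => [|x s1 IHs] k phi.
  rewrite big_nat_recl// subs0 big_seq1 subn0 [X in _ + X]big1 ?addn0//.
  by move=> i _; rewrite big_nil.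
case: k => [|k]; first by rewrite big_nat1 subn0 !subs0 !big_seq1.
rewrite cat_cons big_subsS !IHs [X in _ + X]big_nat_recl// [in RHS]big_nat_recl//.
rewrite !subs0 !big_seq1 addnCA; congr (_ + _).
rewrite -big_split/=; apply: eq_bigr => i _; rewrite big_cat/= big_map.
by rewrite subSS.
Qed.

End Subs.

Lemma big_subs_perm (A : eqType) (phi : seq A -> nat) k (s s' : seq A) :
  (forall t t', perm_eq t t' -> phi t = phi t') -> perm_eq s s' ->
  \sum_(t <- subs k s) phi t = \sum_(t <- subs k s') phi t.
Proof.
move=> phiP.
(* Moving one entry to the front is enough for the induction on [s]. The function is generalised
   because each entry passed over is absorbed into it. *)
have swap (x : A) s1 s2 (f : seq A -> nat) j :
    (forall t t', perm_eq t t' -> f t = f t') ->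
    \sum_(t <- subs j (s1 ++ x :: s2)) f t =
    \sum_(t <- subs j (x :: s1 ++ s2)) f t.
  elim: s1 f j => [|y s1 IHs] f j fP //; case: j => [|j]; first by rewrite !subs0.
  have fyP z t t' : perm_eq t t' -> f (z :: t) = f (z :: t').
    by move=> tt'; apply: fP; rewrite perm_cons.
  rewrite !cat_cons big_subsS !IHs//; last exact: fyP.
  rewrite [RHS]big_subsS [X in _ = _ + X]big_subsS.
  case: j => [|j].
    rewrite big_subsS !subs0 !big_seq1 !addnA; congr (_ + _); exact: addnC.
  rewrite !big_subsS !addnA; congr (_ + _); rewrite addnAC; congr (_ + _ + _).
  apply: eq_bigr => t _; apply: fP.
  rewrite -[_ :: _ :: t]/([:: _; _] ++ _) -[in X in perm_eq _ X]/([:: _; _] ++ _).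
  by rewrite perm_cat2r (perm_catC [:: _] [:: _]).
elim: s s' k phi phiP => [|x s IHs] s' k phi phiP.
  by rewrite perm_sym => /perm_size/size0nil ->.
move=> ss'; have xs' : x \in s' by rewrite -(perm_mem ss') mem_head.
case/splitPr: xs' ss' => s1 s2.
rewrite perm_sym -cat1s perm_catCA perm_cons perm_sym => ss'.
rewrite swap//; case: k => [|k]; first by rewrite !subs0.
rewrite !big_subsS (IHs (s1 ++ s2))//; last first.
  by move=> t t' tt'; apply: phiP; rewrite perm_cons.
by rewrite (IHs (s1 ++ s2) k.+1).
Qed.

Section SubsEq.
Variable A : eqType.
Implicit Types (s t : seq A) (k : nat).

Lemma mem_subs k s t : (t \in subs k s) = subseq t s && (size t == k).
Proof.
elim: s k t => [|x s IHs] [|k] t.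
- by rewrite mem_seq1 subseq0 size_eq0 andbb.
- by rewrite in_nil subseq0; case: t.
- by rewrite mem_seq1 size_eq0; case: eqP => [->|_]; rewrite ?sub0seq ?andbF.
rewrite subsS mem_cat IHs; case: t => [|y t].
  rewrite andbF orbF; apply/negbTE/negP => /mapP[z _].
  by [].
have -> : (y :: t \in map (cons x) (subs k s)) =
          (y == x) && (subseq t s && (size t == k)).
  rewrite -IHs; apply/mapP/andP => [[z zs [-> ->]]//|[/eqP-> ts]].
  by exists t.
have -> : subseq (y :: t) (x :: s) =
          subseq (if y == x then t else y :: t) s by [].
have -> : (size (y :: t) == k.+1) = (size t == k) by [].
have [->|_] := eqVneq y x; last by rewrite andFb.
rewrite andTb -andb_orl; congr (_ && _).
by apply: orb_idr => /cons_subseq.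
Qed.

Lemma subs_uniq k s : uniq s -> uniq (subs k s).
Proof.
elim: s k => [|x s IHs] [|k] // /andP[xs us].
rewrite subsS cat_uniq map_inj_uniq ?IHs//; last by move=> u v [].
rewrite andbT; apply/hasPn => t; rewrite mem_subs => /andP[ts _].
apply: contra xs => /mapP[u _ tE].
by apply: (mem_subseq ts); rewrite tE mem_head.
Qed.

End SubsEq.

Lemma perm_fset_seq (T : choiceType) (s : seq T) :
  uniq s -> perm_eq [fset x in s]%fset s.
Proof.
by move=> us; apply: uniq_perm; rewrite ?fset_uniq// => x; rewrite inE.
Qed.

Lemma card_fset_uniq (T : choiceType) (s : seq T) :
  uniq s -> #|` [fset x in s]%fset| = size s.
Proof. by move=> us; rewrite -(perm_size (perm_fset_seq us)). Qed.

(** Without repetitions each k-subset comes from exactly one sublist, obtained by filtering [s] with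
    membership. *)
Lemma big_fpowerset_card (T : choiceType) (phi : {fset T} -> nat) k (s : seq T) :
  uniq s ->
  \sum_(psi <- fpowerset [fset x in s]%fset | #|` psi| == k) phi psi =
  \sum_(t <- subs k s) phi [fset x in t]%fset.
Proof.
move=> us; rewrite -big_filter -[RHS](big_map (fun t : seq T => [fset x in t]%fset) xpredT).
apply: perm_big; apply: uniq_perm.
- by rewrite filter_uniq// fset_uniq.
- rewrite map_inj_in_uniq ?subs_uniq// => t t'; rewrite !mem_subs.
  move=> /andP[/subseq_uniqP-/(_ us) tE _] /andP[/subseq_uniqP-/(_ us) t'E _] tt'.
  rewrite tE t'E; apply: eq_filter => x.
  by have := congr1 (fun B : {fset T} => x \in B) tt'; rewrite !inE.
- move=> psi; rewrite mem_filter fpowersetE; apply/idP/idP.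
  + case/andP => /eqP psik /fsubsetP psis.
    pose t := [seq x <- s | x \in psi].
    have tE : psi = [fset x in t]%fset.
      apply/fsetP => x; rewrite !inE/= mem_filter.
      by apply/idP/andP => [xpsi|[]//]; split=> //; have := psis _ xpsi; rewrite inE.
    rewrite tE; apply: map_f; rewrite mem_subs filter_subseq -psik.
    by rewrite [in X in _ == X]tE card_fset_uniq ?eqxx ?filter_uniq.
  + case/mapP => t; rewrite mem_subs => /andP[ts /eqP tk] ->; apply/andP; split.
      by apply/eqP; rewrite card_fset_uniq//; exact: subseq_uniq ts us.
    by apply/fsubsetP => x; rewrite !inE; exact: mem_subseq.
Qed.

Local Open Scope ring_scope.

(** * Truncated solutions of the Stein equation *)

(** Supplies the index at which the maximum principles are applied. Index 0 is left out because the
    Stein equation multiplies [f 0] by 0. *)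
Lemma norm_argmax (R : realDomainType) (v : nat -> R) n : (0 < n)%N ->
  exists2 i, (0 < i <= n)%N & forall j, (0 < j <= n)%N -> `|v j| <= `|v i|.
Proof.
elim: n => // -[_ _|n /(_ isT)[i /andP[i0 iN] iP] _].
  by exists 1%N => // -[|[|]].
have [vi|/ltW vi] := leP `|v n.+2| `|v i|.
  exists i; first by rewrite i0 leqW.
  move=> j /andP[j0]; rewrite leq_eqVlt ltnS => /predU1P[->//|jn].
  by apply: iP; rewrite j0.
exists n.+2; first by rewrite leqnn.
move=> j /andP[j0]; rewrite leq_eqVlt ltnS => /predU1P[->//|jn].
by apply: le_trans vi; apply: iP; rewrite j0.
Qed.

Section SteinSolution.
Variables (R : rcfType) (al : R) (g : nat -> R) (M : nat).
Hypotheses (al0 : 0 < al) (alM : al < M%:R).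

Definition stein_wt r : R := al ^+ r / r`!%:R.

(* With these weights the recursion below gives f (M + 1) = f M. *)
Definition stein_refl_wt r : R :=
  if (r < M)%N then (1 - al / M%:R) * stein_wt r else stein_wt r.

Definition stein_mean : R :=
  (\sum_(r < M.+1) stein_refl_wt r * g r) / \sum_(r < M.+1) stein_refl_wt r.

(** The equation leaves the value at 0 free; 0 is the choice that starts the induction [below]
    inside its interval. *)
Fixpoint stein_rec i : R :=
  if i is i'.+1 then (i'%:R * stein_rec i' + g i' - stein_mean) / al else 0.

Definition stein_sol i : R := stein_rec (minn i M).

Let q := stein_wt.
Let w := stein_refl_wt.
Let c := stein_mean.
Let f := stein_sol.
Let u i := f i.+1 - f i.

Let M0 : 0 < M%:R :> R. Proof. exact: lt_trans alM. Qed.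
Let M_gt0 : (0 < M)%N. Proof. by rewrite -(ltr0n R). Qed.

Let q_gt0 r : 0 < q r.
Proof. by rewrite divr_gt0 ?exprn_gt0 ?ltr0n ?fact_gt0. Qed.

Let qS r : r.+1%:R * q r.+1 = al * q r.
Proof.
rewrite /q /stein_wt factS natrM exprS.
have r0 : r.+1%:R != 0 :> R by rewrite pnatr_eq0.
have rf : r`!%:R != 0 :> R by rewrite pnatr_eq0 -lt0n fact_gt0.
by move: (r.+1%:R) r0 (r`!%:R) rf => a a0 b b0; field; rewrite a0 b0.
Qed.

Let aM : 0 < 1 - al / M%:R.
Proof. by rewrite subr_gt0 ltr_pdivrMr// mul1r. Qed.

Let w_ge0 r : 0 <= w r.
Proof.
have q0 := ltW (q_gt0 r); rewrite /w /stein_refl_wt; case: ifP => _ //.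
by rewrite mulr_ge0// ltW.
Qed.

Let sumwE (h : nat -> R) : \sum_(r < M.+1) w r * h r =
  (1 - al / M%:R) * (\sum_(r < M) q r * h r) + q M * h M.
Proof.
rewrite big_ord_recr/= {2}/w /stein_refl_wt ltnn; congr (_ + _).
rewrite mulr_sumr; apply: eq_bigr => r _.
by rewrite /w /stein_refl_wt/= ltn_ord -mulrA.
Qed.

Let sumw_gt0 : 0 < \sum_(r < M.+1) w r.
Proof.
have := sumwE (fun=> 1); under eq_bigr do rewrite mulr1.
move=> ->; rewrite mulr1; apply: ltr_wpDl; last exact: q_gt0.
apply: mulr_ge0; first exact: ltW.
by apply: sumr_ge0 => i _; rewrite mulr1 ltW ?q_gt0.
Qed.

Let meanP : \sum_(r < M.+1) w r * (g r - c) = 0.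
Proof.
under eq_bigr do rewrite mulrBr.
rewrite sumrB -mulr_suml [X in _ - X]mulrC /c /stein_mean divfK ?subrr//.
by rewrite gt_eqF.
Qed.

Lemma stein_mean_le B : (forall r, g r <= B) -> c <= B.
Proof.
move=> gB; rewrite /c /stein_mean ler_pdivrMr// mulr_sumr.
by apply: ler_sum => r _; rewrite mulrC ler_wpM2r.
Qed.

Lemma stein_mean_ge B : (forall r, B <= g r) -> B <= c.
Proof.
move=> gB; rewrite /c /stein_mean ler_pdivlMr// mulr_sumr.
by apply: ler_sum => r _; rewrite mulrC ler_wpM2l.
Qed.

Let sum_sqr m : \sum_(r < m) q r * (r%:R - al) ^+ 2 =
  al * (\sum_(r < m) q r) - m%:R * q m * (m%:R - al).
Proof.
elim: m => [|m IHm]; first by rewrite !big_ord0; ring.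
rewrite !big_ord_recr/= IHm qS -natr1; ring.
Qed.

(** The reflected weights have at most the Poisson variance. Since [(1 - al / M) * M = M - al], the
    boundary term of [sum_sqr] cancels the contribution of M, and the two sides differ by exactly
    [al * q M]. *)
Let sumw_sqr : \sum_(r < M.+1) w r * (r%:R - al) ^+ 2 <=
  al * \sum_(r < M.+1) w r.
Proof.
rewrite (sumwE (fun r => (r%:R - al) ^+ 2)) sum_sqr.
have -> : \sum_(r < M.+1) w r = (1 - al / M%:R) * (\sum_(r < M) q r) + q M.
  have := sumwE (fun=> 1); rewrite mulr1.
  by under eq_bigr do rewrite mulr1; under [in RHS]eq_bigr do rewrite mulr1.
have Mn0 : M%:R != 0 :> R by rewrite gt_eqF.
rewrite -subr_ge0.
have -> : al * ((1 - al / M%:R) * (\sum_(r < M) q r) + q M) -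
  ((1 - al / M%:R) * (al * (\sum_(r < M) q r) - M%:R * q M * (M%:R - al)) +
   q M * (M%:R - al) ^+ 2) = al * q M.
  by field.
by rewrite mulr_ge0 ?ltW.
Qed.

(** [g i - c] is the weighted average of [g i - g r], which is at most |i - al| + |r - al|; the
    average of |r - al| is at most sqrt al by the variance bound. *)
Lemma stein_mean_lip i : (forall r, `|g r.+1 - g r| <= 1) ->
  `|g i - c| <= `|i%:R - al| + Num.sqrt al.
Proof.
move=> gL; set s := Num.sqrt al.
have s0 : 0 < s by rewrite sqrtr_gt0.
have ss : s ^+ 2 = al by rewrite sqr_sqrtr// ltW.
have lip0 a b : `|g (a + b)%N - g a| <= b%:R.
  elim: b => [|b IHb]; first by rewrite addn0 subrr normr0.
  rewrite addnS; have := gL (a + b)%N; rewrite -natr1.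
  move: IHb; rewrite !ler_norml => /andP[? ?] /andP[? ?]; apply/andP; split; lra.
have lip a b : `|g a - g b| <= `|a%:R - b%:R|.
  have [/subnKC <-|/ltnW/subnKC <-] := leqP b a.
    by rewrite natrD addrAC subrr add0r normr_nat.
  by rewrite distrC natrD opprD addrA subrr add0r normrN normr_nat.
(* The inequality 2 |y| <= y^2 / s + s stands in for Cauchy-Schwarz; with s = sqrt al its right side
   averages to at most 2 s. *)
have dist r : `|g i - g r| <= `|i%:R - al| + ((r%:R - al) ^+ 2 / s + s) / 2.
  apply: le_trans (lip _ _) _; apply: le_trans (ler_distD al _ _) _.
  rewrite lerD2l distrC -subr_ge0.
  have -> : ((r%:R - al) ^+ 2 / s + s) / 2 - `|r%:R - al| =
            (`|r%:R - al| - s) ^+ 2 / (2 * s).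
    by rewrite -[(r%:R - al) ^+ 2]real_normK ?num_real//; field; rewrite gt_eqF.
  by rewrite divr_ge0 ?sqr_ge0// mulr_ge0// ltW.
have E : (g i - c) * \sum_(r < M.+1) w r = \sum_(r < M.+1) w r * (g i - g r).
  rewrite -[LHS]subr0 -[X in _ - X = _]meanP mulr_sumr -sumrB.
  by apply: eq_bigr => r _; ring.
rewrite -(ler_pM2r sumw_gt0) -[X in _ * X <= _](gtr0_norm sumw_gt0) -normrM E.
apply: le_trans (ler_norm_sum _ _ _) _.
apply: (@le_trans _ _ (\sum_(r < M.+1)
  w r * (`|i%:R - al| + ((r%:R - al) ^+ 2 / s + s) / 2))).
  by apply: ler_sum => r _; rewrite normrM (ger0_norm (w_ge0 r)) ler_wpM2l.
have -> : \sum_(r < M.+1) w r * (`|i%:R - al| + ((r%:R - al) ^+ 2 / s + s) / 2) =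
  (`|i%:R - al| + s / 2) * (\sum_(r < M.+1) w r) +
  (2 * s)^-1 * \sum_(r < M.+1) w r * (r%:R - al) ^+ 2.
  rewrite !mulr_sumr -big_split/=; apply: eq_bigr => r _.
  by field; rewrite gt_eqF.
apply: le_trans (_ : (`|i%:R - al| + s / 2) * (\sum_(r < M.+1) w r) +
  (2 * s)^-1 * (al * \sum_(r < M.+1) w r) <= _).
  by rewrite lerD2l ler_wpM2l// invr_ge0 mulr_ge0// ltW.
rewrite le_eqVlt; apply/orP; left; apply/eqP.
by rewrite -ss; field; rewrite gt_eqF.
Qed.

Let f_ge i : (M <= i)%N -> f i = stein_rec M.
Proof. by move=> Mi; rewrite /f /stein_sol (minn_idPr Mi). Qed.

Let f_le i : (i <= M)%N -> f i = stein_rec i.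
Proof. by move=> Mi; rewrite /f /stein_sol (minn_idPl Mi). Qed.

Let recS i : al * stein_rec i.+1 = i%:R * stein_rec i + g i - c.
Proof. by rewrite /= mulrC divfK ?gt_eqF. Qed.

Let recE i : al * q i * stein_rec i.+1 = \sum_(r < i.+1) q r * (g r - c).
Proof.
elim: i => [|i IHi]; rewrite big_ord_recr.
  by rewrite big_ord0 mulrAC recS /=; ring.
by rewrite -IHi mulrAC recS -(qS i) /=; ring.
Qed.

(** The purpose of [stein_mean]: multiplied by [al * q M], the difference of the two sides is [(M -
    al) * q M * stein_rec M + q M * (g M - c)], which is the vanishing sum [meanP]. *)
Let recM : stein_rec M.+1 = stein_rec M.
Proof.
have Mn0 : M%:R != 0 :> R by rewrite gt_eqF.
have SM : \sum_(r < M) q r * (g r - c) = M%:R * q M * stein_rec M.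
  have [m Mm] : exists m, M = m.+1 by exists M.-1; rewrite prednK.
  by rewrite [in LHS]Mm -recE -qS -Mm.
have SM1 := recE M; rewrite big_ord_recr/= SM in SM1.
have := meanP; rewrite (sumwE (fun r => g r - c)) SM => E.
apply/eqP; rewrite -subr_eq0; apply/eqP.
apply: (@mulfI _ (al * q M)); first by rewrite mulf_neq0 ?gt_eqF.
rewrite mulr0 mulrBr SM1 -[RHS]E.
by field.
Qed.

Lemma stein_sol_const i : (M <= i)%N -> f i = f M.
Proof. by move=> Mi; rewrite !f_ge. Qed.

Lemma stein_solE i : (i <= M)%N -> al * f i.+1 = i%:R * f i + g i - c.
Proof.
rewrite leq_eqVlt => /predU1P[->|iM].
  by rewrite f_ge// -recM recS f_ge.
by rewrite !f_le// 1?ltnW// recS.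
Qed.

End SteinSolution.

(** * Bounds on solutions of the Stein equation and on their increments *)

Section SteinBounds.
Variables (R : rcfType) (al c : R) (g f : nat -> R) (M : nat).
Hypotheses (al0 : 0 < al) (M_gt0 : (0 < M)%N).
Hypothesis fE : forall i, (i <= M)%N -> al * f i.+1 = i%:R * f i + g i - c.
Hypothesis fM : forall i, (M <= i)%N -> f i = f M.

Let u i := f i.+1 - f i.

Let uM i : (M <= i)%N -> u i = 0.
Proof. by move=> Mi; rewrite /u fM ?(@fM i)// ?subrr// leqW. Qed.

Let uE i : (i <= M)%N -> al * u i = (i%:R - al) * f i + g i - c.
Proof. by move=> iM; rewrite /u mulrBr fE//; ring. Qed.

Let uE' i : (i <= M)%N -> i%:R * u i = (i%:R - al) * f i.+1 + g i - c.
Proof. by move=> iM; rewrite /u; have := fE iM; lra. Qed.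

Let uS i : (i < M)%N ->
  al * u i.+1 = i%:R * u i + (g i.+1 - g i) + f i.+1.
Proof.
by move=> iM; rewrite /u; have := fE iM; have := fE (ltnW iM); rewrite -natr1; lra.
Qed.

Let mul_norm_le (a x S : R) : 0 <= a -> `|x| <= S -> `|a * x| <= a * S.
Proof. by move=> a0 xS; rewrite normrM ger0_norm// ler_wpM2l. Qed.

Section Lipschitz.
Hypothesis gL : forall i, `|g i.+1 - g i| <= 1.

(** Maximum principle: the differenced equation expresses [(al + (j + 1)) * f (j + 1)] by
    [al * f (j + 2) + j * f j] and an increment of g. Where |f| is maximal, the coefficients on the
    right sum to one less than that on the left, which leaves |f| <= 1. *)
Lemma stein_sol_le1 i : (0 < i)%N -> `|f i| <= 1.
Proof.
have [j jM jP] := norm_argmax f M_gt0.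
have fj k : (0 < k)%N -> `|f k| <= `|f j|.
  move=> k0; have [kM|/ltnW Mk] := leqP k M; first by rewrite jP// k0.
  by rewrite (fM Mk) jP// M_gt0 leqnn.
move=> /fj/le_trans; apply.
case: j jM jP fj => [//|j] /andP[_ jM] _ fj.
have e1 := fE jM; have e2 := fE (ltnW jM).
set S := `|f j.+1| in fj *.
have a1 := mul_norm_le (ltW al0) (fj j.+2 isT).
have a2 : `|j%:R * f j| <= j%:R * S.
  case: (posnP j) => [->|j0]; first by rewrite !mul0r normr0.
  exact: mul_norm_le (fj _ j0).
have E : (al + j.+1%:R) * f j.+1 = al * f j.+2 + j%:R * f j - (g j.+1 - g j).
  by move: e1 e2; rewrite -natr1; lra.
have aj : 0 <= al + j.+1%:R by rewrite addr_ge0// ltW.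
have := congr1 Num.norm E; rewrite normrM (ger0_norm aj) -/S => E'.
have : (al + j.+1%:R) * S <= al * S + j%:R * S + 1.
  rewrite E'; apply: le_trans (ler_normB _ _) _; apply: lerD => //.
  by apply: le_trans (ler_normD _ _) _; exact: lerD.
by rewrite -natr1; lra.
Qed.

Lemma stein_diff_le2 i : (0 < i)%N -> `|u i| <= 2.
Proof.
move=> i0; apply: le_trans (ler_normB _ _) _.
by have := stein_sol_le1 i0; have := stein_sol_le1 (ltn0Sn i); lra.
Qed.

Hypothesis gc : forall i, `|g i - c| <= `|i%:R - al| + Num.sqrt al.

Lemma stein_diff_le_sqrt i : (0 < i)%N -> `|u i| <= 3 / Num.sqrt al.
Proof.
move=> i0; set s := Num.sqrt al.
have s0 : 0 < s by rewrite sqrtr_gt0.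
have ss : s * s = al by rewrite -expr2 sqr_sqrtr// ltW.
have us k : (k < M)%N -> `|g k.+1 - g k + f k.+1| <= 2.
  move=> _; apply: le_trans (ler_normD _ _) _.
  by have := gL k; have := stein_sol_le1 (ltn0Sn k); lra.
have le23 : 2 / s <= 3 / s by rewrite ler_pM2r ?invr_gt0// ler_nat.
have [iM|/ltnW/uM->] := leqP i M; last by rewrite normr0 divr_ge0// ltW.
have [is_|is_] := leP `|i%:R - al| s.
- rewrite ler_pdivlMr// -(ler_pM2l s0) mulrCA ss mulrC.
  rewrite -[X in X * `|_|](gtr0_norm al0) -normrM uE//.
  rewrite -addrA; apply: le_trans (ler_normD _ _) _.
  have := gc i; rewrite -/s.
  have := mul_norm_le (normr_ge0 (i%:R - al)) (stein_sol_le1 i0).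
  rewrite !normrM normr_id mulr1; lra.
have [ia|ia] := leP al i%:R.
(* Downward induction from M, where u vanishes. The step loses at most 2, and
   [al * (2 / s) + 2 <= i * (2 / s)] is exactly the condition al + s <= i. *)
- rewrite ger0_norm ?subr_ge0// in is_; apply: le_trans le23.
  have [m Mm] : exists m, (i + m)%N = M by exists (M - i)%N; rewrite subnKC.
  elim: m i i0 iM ia is_ Mm => [|m IHm] i i0 iM ia is_ Mm.
    by rewrite uM ?normr0 ?divr_ge0 ?ltW// -Mm addn0.
  have iM' : (i < M)%N by rewrite -Mm addnS ltnS leq_addr.
  have ii : i%:R <= i.+1%:R :> R by rewrite ler_nat.
  have IH := IHm i.+1 isT iM' (le_trans ia ii) (lt_le_trans is_ (lerB ii (lexx _))).
  have {}IH : `|u i.+1| <= 2 / s by apply: IH; rewrite addSnnS.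
  have E : i%:R * u i = al * u i.+1 - (g i.+1 - g i + f i.+1).
    by rewrite uS//; ring.
  have ip : 0 < i%:R :> R by rewrite ltr0n.
  rewrite -(ler_pM2l ip) -[X in X * `|_|](gtr0_norm ip) -normrM E.
  apply: le_trans (ler_normB _ _) _.
  apply: le_trans (lerD (mul_norm_le (ltW al0) IH) (us i iM')) _.
  rewrite -(ler_pM2r s0) mulrDl -!mulrA mulVf ?gt_eqF// !mulr1.
  by nra.
(* Upward induction, started by the factor i = 0 in [uS]; it closes because
   [i * (2 / s) + 2 <= al * (2 / s)] as soon as i + s <= al. *)
- rewrite ltr0_norm ?subr_lt0// opprB in is_; apply: le_trans le23.
  elim: i i0 iM ia is_ => [//|i IHi] _ iM ia is_.
  have ii : i%:R <= i.+1%:R :> R by rewrite ler_nat.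
  have a2 : `|i%:R * u i| <= i%:R * (2 / s).
    case: (posnP i) => [->|j0]; first by rewrite !mul0r normr0.
    apply: mul_norm_le => //; apply: IHi => //; first exact: ltnW.
      exact: le_lt_trans ii ia.
    by apply: lt_le_trans is_ _; lra.
  rewrite -(ler_pM2l al0) -[X in X * `|_|](gtr0_norm al0) -normrM uS//.
  rewrite -addrA; apply: le_trans (ler_normD _ _) _.
  apply: le_trans (lerD a2 (us i iM)) _.
  rewrite -(ler_pM2r s0) mulrDl -!mulrA mulVf ?gt_eqF// !mulr1.
  by move: is_; rewrite -natr1; nra.
Qed.

End Lipschitz.

Section Indicator.
Hypothesis g01 : forall i, 0 <= g i <= 1.
Hypothesis c01 : 0 <= c <= 1.

(** Maximum principle for the twice differenced equation: the coefficients of u now differ by 2, and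
    a second difference of a function with values in [0, 1] is at most 2. *)
Lemma stein_diff_le1 i : (0 < i)%N -> `|u i| <= 1.
Proof.
have [j jM jP] := norm_argmax u M_gt0.
have fj k : (0 < k)%N -> `|u k| <= `|u j|.
  move=> k0; have [kM|/ltnW Mk] := leqP k M; first by rewrite jP// k0.
  by rewrite uM ?normr0.
move=> /fj/le_trans; apply.
case: j jM jP fj => [//|j] /andP[_]; rewrite leq_eqVlt => /predU1P[jM|jM] _ fj.
  by rewrite uM ?jM// normr0 ler01.
have e1 := uS jM; have e2 := uS (ltnW jM).
set S := `|u j.+1| in fj *.
have a1 := mul_norm_le (ltW al0) (fj j.+2 isT).
have a2 : `|j%:R * u j| <= j%:R * S.
  case: (posnP j) => [->|j0]; first by rewrite !mul0r normr0.
  exact: mul_norm_le (fj _ j0).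
have E : (al + j.+2%:R) * u j.+1 =
    al * u j.+2 + j%:R * u j - ((g j.+2 - g j.+1) - (g j.+1 - g j)).
  by move: e1 e2; rewrite -!natr1 /u; lra.
have aj : 0 <= al + j.+2%:R by rewrite addr_ge0// ltW.
have := congr1 Num.norm E; rewrite normrM (ger0_norm aj) -/S => E'.
have g2 : `|(g j.+2 - g j.+1) - (g j.+1 - g j)| <= 2.
  move: (g01 j) (g01 j.+1) (g01 j.+2) => /andP[? ?] /andP[? ?] /andP[? ?].
  by rewrite ler_norml; apply/andP; split; lra.
have : (al + j.+2%:R) * S <= al * S + j%:R * S + 2.
  rewrite E'; apply: le_trans (ler_normB _ _) _; apply: lerD => //.
  by apply: le_trans (ler_normD _ _) _; exact: lerD.
by rewrite -!natr1; lra.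
Qed.

Hypothesis f0 : f 0%N = 0.

Let shrink (a b x lo hi : R) : 0 <= a -> a <= b -> lo <= 0 -> 0 <= hi ->
  lo <= b * x <= hi -> lo <= a * x <= hi.
Proof.
move=> a0 ab lo0 hi0 /andP[lob bhi].
have [x0|/ltW x0] := leP 0 x.
  have := ler_wpM2r x0 ab; have := mulr_ge0 a0 x0; move=> ? ?.
  by apply/andP; split; lra.
have := ler_wnM2r x0 ab; have := mulr_ge0_le0 a0 x0; move=> ? ?.
by apply/andP; split; lra.
Qed.

Let avg (a b x y z lo hi : R) : 0 <= a -> 0 <= b -> 0 < a + b ->
  lo <= x <= hi -> lo <= y <= hi -> (a + b) * z = a * x + b * y ->
  lo <= z <= hi.
Proof.
move=> a0 b0 ab /andP[lx xh] /andP[ly yh] E.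
have := ler_wpM2l a0 lx; have := ler_wpM2l a0 xh.
have := ler_wpM2l b0 ly; have := ler_wpM2l b0 yh => ? ? ? ?.
by rewrite -(ler_pM2l ab) -(ler_pM2l ab z) E; apply/andP; split; lra.
Qed.

Let gcE i : - c <= g i - c <= 1 - c.
Proof. by have := g01 i; move=> /andP[? ?]; apply/andP; split; lra. Qed.

(** [(al - i) * f (i + 1)] is the average of [(al - i) * f i] and [g i - c] with weights i / al and
    (al - i) / al. Both lie in an interval containing 0, so lowering the factor to al - (i + 1)
    stays inside it. *)
Let below i : (i <= M)%N -> i%:R <= al -> - c <= (al - i%:R) * f i <= 1 - c.
Proof.
move: c01 => /andP[c0 c1].
elim: i => [|i IHi] iM ia.
  by rewrite f0 mulr0; apply/andP; split; lra.
have ii : i%:R <= al by apply: le_trans ia; rewrite ler_nat.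
apply: (@shrink _ (al - i%:R)); rewrite ?subr_ge0//; try lra.
apply: (@avg i%:R (al - i%:R) ((al - i%:R) * f i) (g i - c)) => //.
- by rewrite subr_ge0.
- by rewrite addrC subrK.
- by apply: IHi => //; exact: ltnW.
- rewrite addrC subrK mulrCA (fE (ltnW iM)); ring.
Qed.

(** The mirror image of [below], by downward induction: at M the equation reads
    [(M - al) * f M = c - g M], and the weights are al and i + 1 - al. *)
Let above i : (i <= M)%N -> al <= i%:R -> c - 1 <= (i%:R - al) * f i.+1 <= c.
Proof.
move=> iM ia; move: c01 => /andP[c0 c1].
have cg k : c - 1 <= c - g k <= c.
  by have := g01 k => /andP[? ?]; apply/andP; split; lra.
have [m Mm] : exists m, (i + m)%N = M by exists (M - i)%N; rewrite subnKC.
elim: m i iM ia Mm => [|m IHm] i iM ia Mm.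
  rewrite addn0 in Mm; rewrite Mm.
  rewrite (fM (leqnSn M)); have := fE (leqnn M); rewrite (fM (leqnSn M)) => E.
  by have -> : (M%:R - al) * f M = c - g M by lra.
have iM' : (i < M)%N by rewrite -Mm addnS ltnS leq_addr.
have ii : al <= i.+1%:R by apply: le_trans ia _; rewrite ler_nat.
have IH : c - 1 <= (i.+1%:R - al) * f i.+2 <= c by apply: IHm; rewrite // addSnnS.
apply: (@shrink _ (i.+1%:R - al)); rewrite ?subr_ge0//; try lra.
apply: (@avg al (i.+1%:R - al) ((i.+1%:R - al) * f i.+2) (c - g i.+1)) => //.
- exact: ltW.
- by rewrite subr_ge0.
- by rewrite addrC subrK ltr0n.
- rewrite addrC subrK; have := fE iM' => E.
  by rewrite mulrCA [al * _]mulrCA E; ring.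
Qed.

(** Up to al, [al * u i] is a difference of two points of an interval of length one, namely
    [g i - c] and [(al - i) * f i]. Above al the same holds for [i * u i], and al < i. *)
Lemma stein_diff_le_inv i : (0 < i)%N -> `|u i| <= al^-1.
Proof.
move=> i0; rewrite -[al^-1]mul1r ler_pdivlMr// mulrC.
rewrite -[X in X * `|_|](gtr0_norm al0) -normrM.
move: (g01 i) c01 => /andP[? ?] /andP[? ?].
have [iM|/ltnW/uM->] := leqP i M; last by rewrite mulr0 normr0.
have [/ltW ia|ia] := ltP i%:R al.
  have /andP[? ?] := below iM ia.
  by rewrite uE// ler_norml; apply/andP; split; lra.
have /andP[? ?] := above iM ia.
have : `|i%:R * u i| <= 1 by rewrite uE'// ler_norml; apply/andP; split; lra.
apply: le_trans; rewrite !normrM ler_wpM2r//.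
by rewrite gtr0_norm// normr_nat.
Qed.

End Indicator.
End SteinBounds.

(** * Comparison with the Poisson law *)

Section Comparison.
Variable R : rcfType.
Implicit Types (phi psi g : nat -> R) (E : (nat -> R) -> R).

Definition lin_growth phi := exists C, forall i, `|phi i| <= C * (1 + i%:R).

Definition tail_weight (m i : nat) : R := (m < i)%N%:R * (1 + i%:R).

(** The expectation under a law on nat with mean al, reduced to the properties used by the
    comparison. [mean_tail] expresses integrability as vanishing of the first-moment tails. *)
Record mean_functional (al : R) E : Prop := MeanFunctional {
  meanD : forall phi psi, lin_growth phi -> lin_growth psi ->
    E (fun i => phi i + psi i) = E phi + E psi;
  meanZ : forall a phi, lin_growth phi -> E (fun i => a * phi i) = a * E phi;
  mean_le : forall phi psi, lin_growth phi -> lin_growth psi ->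
    (forall i, phi i <= psi i) -> E phi <= E psi;
  mean1 : E (fun=> 1) = 1;
  mean_id : E (fun i => i%:R) = al;
  mean_tail : forall e, 0 < e ->
    exists m, forall M, (m <= M)%N -> E (tail_weight M) <= e }.

(* The D_j of the header; it vanishes for the Poisson law with mean al. *)
Definition mean_gap al E (j : nat) : R :=
  E (fun i => (j <= i)%N%:R * i%:R) - al * E (fun i => (j <= i.+1)%N%:R).

Lemma lin_growthD phi psi : lin_growth phi -> lin_growth psi ->
  lin_growth (fun i => phi i + psi i).
Proof.
move=> [C phiC] [D psiD]; exists (C + D) => i; rewrite mulrDl.
by apply: le_trans (ler_normD _ _) _; exact: lerD.
Qed.

Lemma lin_growthZ a phi : lin_growth phi -> lin_growth (fun i => a * phi i).
Proof.
move=> [C phiC]; exists (`|a| * C) => i.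
by rewrite normrM -mulrA ler_wpM2l.
Qed.

Let i1_ge0 i : 0 <= 1 + i%:R :> R.
Proof. by rewrite addr_ge0. Qed.

Lemma lin_growth_cst a : lin_growth (fun=> a).
Proof.
exists `|a| => i; rewrite -[X in X <= _]mulr1 ler_wpM2l// lerDl//.
Qed.

Lemma lin_growth_nat (b : nat -> bool) : lin_growth (fun i => (b i)%:R * i%:R).
Proof.
exists 1 => i; rewrite mul1r normrM !normr_nat.
by case: (b i); rewrite ?mul1r ?mul0r// lerDr.
Qed.

Lemma lin_growth_id : lin_growth (fun i => i%:R).
Proof. by exists 1 => i; rewrite mul1r normr_nat lerDr. Qed.

Lemma lin_growth_ind (b : nat -> bool) : lin_growth (fun i => (b i)%:R).
Proof.
exists 1 => i; rewrite mul1r normr_nat.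
by case: (b i) => //; rewrite lerDl.
Qed.

Lemma lin_growth_tail m : lin_growth (tail_weight m).
Proof.
exists 1 => i; rewrite mul1r /tail_weight normrM normr_nat (ger0_norm (i1_ge0 i)).
by case: (_ < _)%N; rewrite ?mul1r ?mul0r.
Qed.

Lemma lin_growth_sum (I : Type) (r : seq I) (h : I -> nat -> R) :
  (forall j, lin_growth (h j)) -> lin_growth (fun i => \sum_(j <- r) h j i).
Proof.
move=> hP; elim: r => [|j r IHr].
  by under eq_fun do rewrite big_nil; exact: lin_growth_cst.
by under eq_fun do rewrite big_cons; exact: lin_growthD.
Qed.

Section Mean.
Variables (al : R) (E : (nat -> R) -> R).
Hypothesis EP : mean_functional al E.

Lemma mean_cst a : E (fun=> a) = a.
Proof.
have := meanZ EP a (lin_growth_cst 1); rewrite (mean1 EP) mulr1 => E1.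
by rewrite -[RHS]E1; congr E; apply: funext => i; rewrite mulr1.
Qed.

Lemma mean_sum (I : Type) (r : seq I) (h : I -> nat -> R) :
  (forall j, lin_growth (h j)) ->
  E (fun i => \sum_(j <- r) h j i) = \sum_(j <- r) E (h j).
Proof.
move=> hP; elim: r => [|j r IHr].
  by under eq_fun do rewrite big_nil; rewrite mean_cst big_nil.
under eq_fun do rewrite big_cons; rewrite big_cons -IHr (meanD EP)//.
exact: lin_growth_sum.
Qed.

Lemma mean_norm_le C m phi : lin_growth phi ->
  (forall i, `|phi i| <= C * tail_weight m i) ->
  `|E phi| <= C * E (tail_weight m).
Proof.
move=> lp phiC; have lt := lin_growth_tail m.
rewrite ler_norml -mulNr -!(meanZ EP)//; apply/andP; split;
  apply: (mean_le EP) => //; try exact: lin_growthZ.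
- by move=> i; have := phiC i; rewrite ler_norml => /andP[]; rewrite mulNr.
- by move=> i; have := phiC i; rewrite ler_norml => /andP[].
Qed.

(** Write f(i), for i > 0, as f(1) plus increments. The coefficient of f(1) is al minus the mean,
    hence 0; each remaining increment multiplies a [mean_gap]. Constancy from M on keeps the sum
    finite. *)
Lemma mean_stein_op f M : (0 < M)%N -> (forall i, (M <= i)%N -> f i = f M) ->
  lin_growth (fun i => al * f i.+1 - i%:R * f i) /\
  E (fun i => al * f i.+1 - i%:R * f i) =
    - \sum_(1 <= j < M) (f j.+1 - f j) * mean_gap al E j.+1.
Proof.
move=> M0 fM.
pose h j i : R := (f j.+1 - f j) *
  (al * (j <= i)%N%:R + (- 1) * ((j.+1 <= i)%N%:R * i%:R)).
have fE i : (0 < i)%N ->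
    f i = f 1%N + \sum_(1 <= j < M) (f j.+1 - f j) * (j.+1 <= i)%N%:R.
  move=> i0; have [iM|/ltnW Mi] := leqP i M.
    rewrite (big_cat_nat i0 iM)/= [X in _ + (_ + X)]big_nat.
    rewrite [X in _ + (_ + X)]big1 ?addr0; last first.
      by move=> j /andP[ij _]; rewrite ltnNge ij mulr0.
    rewrite big_nat (eq_bigr (fun j => f j.+1 - f j)) => [|j /andP[_ ->]]; last first.
      by rewrite mulr1.
    by rewrite -big_nat telescope_sumr// addrC subrK.
  rewrite big_nat (eq_bigr (fun j => f j.+1 - f j)) => [|j /andP[_ jM]]; last first.
    by rewrite (leq_trans jM Mi) mulr1.
  by rewrite -big_nat telescope_sumr// addrC subrK fM.
have HE : (fun i => al * f i.+1 - i%:R * f i) =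
    (fun i => f 1%N * (al + (- 1) * i%:R) + \sum_(1 <= j < M) h j i).
  apply: funext => i; rewrite (fE i.+1)//.
  have -> : i%:R * f i = i%:R * f 1%N +
      \sum_(1 <= j < M) (f j.+1 - f j) * ((j.+1 <= i)%N%:R * i%:R).
    case: i => [|i].
      by rewrite !mul0r big1 ?addr0// => j _; rewrite mul0r mulr0.
    rewrite {1}(fE i.+1)// mulrDr mulr_sumr; congr (_ + _).
    by apply: eq_bigr => j _; ring.
  rewrite mulrDr mulr_sumr opprD addrACA -sumrB; congr (_ + _); first by ring.
  by apply: eq_bigr => j _; rewrite /h ltnS; ring.
have lh j : lin_growth (h j).
  apply/lin_growthZ/lin_growthD; apply/lin_growthZ.
    exact: lin_growth_ind.
  exact: (@lin_growth_nat (fun i => (j.+1 <= i)%N)).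
have l1 : lin_growth (fun i => al + -1 * i%:R).
  by apply/lin_growthD; [exact: lin_growth_cst | exact/lin_growthZ/lin_growth_id].
rewrite HE; split.
  by apply/lin_growthD; [exact: lin_growthZ | exact: lin_growth_sum].
rewrite (meanD EP); [|exact: lin_growthZ|exact: lin_growth_sum].
rewrite (meanZ EP)// (meanD EP); [|exact: lin_growth_cst|exact/lin_growthZ/lin_growth_id].
rewrite mean_cst (meanZ EP); last exact: lin_growth_id.
rewrite (mean_id EP) mulN1r subrr mulr0 add0r mean_sum// -sumrN.
apply: eq_bigr => j _; rewrite /h (meanZ EP); last first.
  apply/lin_growthD; apply/lin_growthZ; first exact: lin_growth_ind.
  exact: (@lin_growth_nat (fun i => (j.+1 <= i)%N)).
rewrite (meanD EP); [|exact/lin_growthZ/lin_growth_ind|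
  exact/lin_growthZ/(@lin_growth_nat (fun i => (j.+1 <= i)%N))].
rewrite (meanZ EP); last exact: lin_growth_ind.
rewrite (meanZ EP); last exact: (@lin_growth_nat (fun i => (j.+1 <= i)%N)).
by rewrite /mean_gap; ring.
Qed.

End Mean.

(** The bounds on [f M] and [c] do not depend on M, so the error beyond M is controlled by a fixed
    multiple of [tail_weight M]. *)
Lemma mean_dist_le (al Gam K C0 : R) (E1 E2 : (nat -> R) -> R) g M0 :
  0 < al -> mean_functional al E1 -> mean_functional al E2 ->
  (forall j, 0 <= mean_gap al E1 j) ->
  (forall m, \sum_(j < m) mean_gap al E1 j <= Gam) ->
  (forall j, mean_gap al E2 j = 0) ->
  lin_growth g -> 0 <= K ->
  (forall M, (M0 <= M)%N -> exists f c,
    [/\ forall i, (i <= M)%N -> al * f i.+1 = i%:R * f i + g i - c,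
        forall i, (M <= i)%N -> f i = f M,
        forall i, (0 < i)%N -> `|f i.+1 - f i| <= K,
        `|f M| <= 1 & `|c| <= C0]) ->
  `|E1 g - E2 g| <= K * Gam.
Proof.
move=> al0 E1P E2P D0 DG D2 lg K0 sol; have [Cg gC] := lg.
have Cg0 : 0 <= Cg.
  by have := le_trans (normr_ge0 _) (gC 0%N); rewrite addr0 mulr1.
have C00 : 0 <= C0.
  by have [f [c [_ _ _ _]]] := sol M0 (leqnn _); exact: le_trans.
(* Beyond M the error is al f(M) - i f(M) + c - g(i); the four summands of C dominate these terms
   after multiplication by 1 + i. *)
pose C := al + 1 + C0 + Cg.
have C_gt0 : 0 < C by rewrite /C; lra.
apply/ler_addgt0Pr => e e0.
have e2 : 0 < e / (2 * C) by rewrite divr_gt0// mulr_gt0.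
have [m1 m1P] := mean_tail E1P e2; have [m2 m2P] := mean_tail E2P e2.
pose M := maxn (maxn m1 m2) M0.+1.
have M1 : (m1 <= M)%N by rewrite !leq_max leqnn.
have M2 : (m2 <= M)%N by rewrite !leq_max leqnn orbT.
have M0M : (M0 < M)%N by rewrite !leq_max leqnn orbT.
have [f [c [fE fM uK f1 cC]]] := sol M (ltnW M0M).
have Mgt0 : (0 < M)%N by exact: leq_ltn_trans M0M.
pose h i := al * f i.+1 - i%:R * f i.
pose e' i := h i + c - g i.
have [lh Eh1] := mean_stein_op E1P Mgt0 fM.
have [_ Eh2] := mean_stein_op E2P Mgt0 fM.
have le : lin_growth e'.
  apply: lin_growthD; first by apply: lin_growthD => //; exact: lin_growth_cst.
  by case: lg => D gD; exists D => i; rewrite normrN.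
have e'C i : `|e' i| <= C * tail_weight M i.
  rewrite /e' /h /tail_weight; have [iM|Mi] := leqP i M.
    by rewrite fE// mul0r mulr0 [X in `|X|](_ : _ = 0) ?normr0//; ring.
  rewrite mul1r (@fM i (ltnW Mi)) (@fM i.+1 (leqW (ltnW Mi))).
  have a1 : `|al * f M| <= al by rewrite normrM gtr0_norm// ler_piMr// ltW.
  have a2 : `|i%:R * f M| <= i%:R by rewrite normrM normr_nat ler_piMr.
  apply: le_trans (ler_normB _ _) _.
  apply: le_trans (lerD (ler_normD _ _) (gC i)) _.
  apply: le_trans (lerD (lerD (ler_normB _ _) cC) (lexx _)) _.
  apply: le_trans (lerD (lerD (lerD a1 a2) (lexx _)) (lexx _)) _.
  have i0 : 0 <= i%:R :> R by [].
  have := mulr_ge0 (ltW al0) i0; have := mulr_ge0 C00 i0.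
  by rewrite /C; lra.
have gE E : mean_functional al E -> E g = E h + c - E e'.
  move=> EP; have -> : E e' = E (fun i => (h i + c) + (-1) * g i).
    by congr E; apply: funext => i; rewrite /e' mulN1r.
  have l1 : lin_growth (fun i => h i + c).
    by apply: lin_growthD => //; exact: lin_growth_cst.
  have l2 : lin_growth (fun i => -1 * g i) by exact: lin_growthZ.
  rewrite (meanD EP l1 l2) (meanD EP lh (lin_growth_cst c)) (meanZ EP _ lg).
  by rewrite (mean_cst EP); ring.
have E2h : E2 h = 0.
  by rewrite [LHS]Eh2 big1 ?oppr0// => j _; rewrite D2 mulr0.
have E1h : `|E1 h| <= K * Gam.
  rewrite [E1 h]Eh1 normrN; apply: le_trans (ler_norm_sum _ _ _) _.
  apply: (@le_trans _ _ (K * \sum_(1 <= j < M) mean_gap al E1 j.+1)).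
    rewrite mulr_sumr big_nat [leRHS]big_nat; apply: ler_sum => j /andP[j0 _].
    by rewrite normrM (ger0_norm (D0 _)) ler_wpM2r// uK.
  rewrite ler_wpM2l//; apply: le_trans (DG M.+1).
  rewrite -(big_mkord xpredT) big_nat_recl//.
  rewrite [in leRHS](big_ltn Mgt0) addrA lerDr.
  by rewrite addr_ge0.
have E1e : `|E1 e'| <= C * (e / (2 * C)).
  apply: le_trans (mean_norm_le E1P le e'C) _.
  by rewrite ler_pM2l// m1P.
have E2e : `|E2 e'| <= C * (e / (2 * C)).
  apply: le_trans (mean_norm_le E2P le e'C) _.
  by rewrite ler_pM2l// m2P.
have Ce : C * (e / (2 * C)) = e / 2 by field; rewrite gt_eqF.
rewrite Ce in E1e E2e.
rewrite (gE _ E1P) (gE _ E2P) E2h.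
(* Here the centring c cancels, so its distance to the mean of g never has to be estimated. *)
have -> : E1 h + c - E1 e' - (0 + c - E2 e') = E1 h - (E1 e' - E2 e') by ring.
apply: le_trans (ler_normB _ _) _; apply: lerD => //.
by apply: le_trans (ler_normB _ _) _; lra.
Qed.

(** A nonnegative variable with mean 0 vanishes almost surely: [tail_weight 0 i <= 2 * i], so its
    mean is at most 0, and it dominates the deviation of g from [g 0]. *)
Lemma mean_degenerate (E : (nat -> R) -> R) g :
  mean_functional 0 E -> lin_growth g -> E g = g 0%N.
Proof.
move=> EP lg; have [C gC] := lg.
have l0 := lin_growth_cst (g 0%N).
pose e i := g i + (-1) * g 0%N.
have le : lin_growth e by apply: lin_growthD => //; exact: lin_growthZ.
have C0 : 0 <= C by have := le_trans (normr_ge0 _) (gC 0%N); rewrite addr0 mulr1.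
have E0 : E (tail_weight 0) <= 0.
  have <- : 2 * E (fun i => i%:R) = 0 by rewrite (mean_id EP) mulr0.
  rewrite -(meanZ EP _ lin_growth_id); apply: (mean_le EP).
  - exact: lin_growth_tail.
  - exact/lin_growthZ/lin_growth_id.
  - case=> [|i]; first by rewrite /tail_weight mul0r mulr0.
    by rewrite /tail_weight mul1r -natr1; have := ler0n R i; lra.
have eC i : `|e i| <= (C + `|g 0%N|) * tail_weight 0 i.
  rewrite /e /tail_weight mulN1r; case: i => [|i].
    by rewrite subrr normr0 mul0r mulr0.
  rewrite mul1r; apply: le_trans (ler_normB _ _) _; rewrite mulrDl.
  by apply: lerD => //; rewrite ler_peMr// lerDl.
have : `|E e| <= 0.
  apply: le_trans (mean_norm_le EP le eC) _.
  by rewrite mulr_ge0_le0// addr_ge0.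
rewrite normr_le0 (meanD EP lg (lin_growthZ _ l0)) (meanZ EP _ l0) (mean_cst EP).
by rewrite mulN1r subr_eq0 => /eqP.
Qed.

Definition lip1 g := forall i, `|g i.+1 - g i| <= 1.

Lemma lin_growth_lip g : lip1 g -> lin_growth g.
Proof.
move=> gL; exists (`|g 0%N| + 1) => i.
have : `|g i - g 0%N| <= i%:R.
  elim: i => [|i IHi]; first by rewrite subrr normr0.
  by rewrite -natr1; have := gL i; move: IHi; rewrite !ler_norml =>
    /andP[? ?] /andP[? ?]; apply/andP; split; lra.
move=> gi; rewrite -[g i](subrK (g 0%N)).
apply: le_trans (ler_normD _ _) _.
have := mulr_ge0 (normr_ge0 (g 0%N)) (ler0n R i); lra.
Qed.

Lemma mean_dist_lip (al Gam : R) (E1 E2 : (nat -> R) -> R) g :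
  0 < al -> mean_functional al E1 -> mean_functional al E2 ->
  (forall j, 0 <= mean_gap al E1 j) ->
  (forall m, \sum_(j < m) mean_gap al E1 j <= Gam) ->
  (forall j, mean_gap al E2 j = 0) -> lip1 g ->
  forall M0, al < M0%:R ->
  `|E1 g - E2 g| <= 3 * Num.min 1 (Num.sqrt al)^-1 * Gam.
Proof.
move=> al0 E1P E2P D0 DG D2 gL M0 alM0; have lg := lin_growth_lip gL.
have s0 : 0 < Num.sqrt al by rewrite sqrtr_gt0.
have K0 : 0 <= 3 * Num.min 1 (Num.sqrt al)^-1.
  by rewrite mulr_ge0// le_min ler01 invr_ge0 ltW.
apply: (@mean_dist_le al Gam _ (`|g 0%N| + (al + Num.sqrt al)) _ _ g M0 al0
  E1P E2P D0 DG D2 lg K0).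
move=> M MM; have alM : al < M%:R by apply: lt_le_trans alM0 _; rewrite ler_nat.
have M_gt0 : (0 < M)%N by rewrite -(ltr0n R) (lt_trans al0).
have fE := stein_solE g al0 alM; have fM := stein_sol_const al g (M := M).
have gc := stein_mean_lip al0 alM ^~ gL.
exists (stein_sol al g M), (stein_mean al g M); split=> //.
- move=> i i0; have [_|_] := leP 1 (Num.sqrt al)^-1; last first.
    exact: (stein_diff_le_sqrt al0 M_gt0 fE fM gL gc).
  rewrite mulr1; apply: le_trans (stein_diff_le2 al0 M_gt0 fE fM gL i0) _.
  by rewrite ler_nat.
- exact: (stein_sol_le1 al0 M_gt0 fE fM gL).
(* [gc] at 0 bounds the centring independently of M. *)
- rewrite -[stein_mean _ _ _](subKr (g 0%N)); apply: le_trans (ler_normB _ _) _.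
  by rewrite lerD2l; have := gc 0%N; rewrite sub0r normrN (gtr0_norm al0).
Qed.

Lemma mean_dist_ind (al Gam : R) (E1 E2 : (nat -> R) -> R) g :
  0 < al -> mean_functional al E1 -> mean_functional al E2 ->
  (forall j, 0 <= mean_gap al E1 j) ->
  (forall m, \sum_(j < m) mean_gap al E1 j <= Gam) ->
  (forall j, mean_gap al E2 j = 0) -> (forall i, 0 <= g i <= 1) ->
  forall M0, al + 1 < M0%:R ->
  `|E1 g - E2 g| <= Num.min 1 al^-1 * Gam.
Proof.
move=> al0 E1P E2P D0 DG D2 g01 M0 alM0.
have lg : lin_growth g.
  exists 1 => i; have /andP[g0 g1] := g01 i; rewrite ger0_norm// mul1r.
  by apply: le_trans g1 _; rewrite lerDl.
have K0 : 0 <= Num.min 1 al^-1 by rewrite le_min ler01 invr_ge0 ltW.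
apply: (@mean_dist_le al Gam _ 1 _ _ g M0 al0 E1P E2P D0 DG D2 lg K0).
move=> M MM; have alM1 : al + 1 < M%:R by apply: lt_le_trans alM0 _; rewrite ler_nat.
have alM : al < M%:R by lra.
have M_gt0 : (0 < M)%N by rewrite -(ltr0n R) (lt_trans al0).
have fE := stein_solE g al0 alM; have fM := stein_sol_const al g (M := M).
have c01 : 0 <= stein_mean al g M <= 1.
  apply/andP; split; [apply: stein_mean_ge|apply: stein_mean_le] => // i;
  by have /andP[] := g01 i.
exists (stein_sol al g M), (stein_mean al g M); split=> //.
- move=> i i0; have [_|_] := leP 1 al^-1.
    exact: (stein_diff_le1 al0 M_gt0 fE fM g01).
  apply: (stein_diff_le_inv al0 fE fM g01 c01) => //.
  by rewrite /stein_sol min0n.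
(* At M the equation gives (M - al) f(M) = c - g(M), of absolute value at most 1; |f(M)| <= 1
   follows because M exceeds al + 1. *)
- have := fE M (leqnn _); rewrite (fM M.+1)// => E.
  have {}E : (M%:R - al) * stein_sol al g M M = stein_mean al g M - g M by lra.
  have : (M%:R - al) * `|stein_sol al g M M| <= 1.
    have Mal : 0 <= M%:R - al by lra.
    rewrite -[X in X * _](ger0_norm Mal) -normrM E.
    have /andP[? ?] := g01 M; move/andP: c01 => [? ?].
    by rewrite ler_norml; apply/andP; split; lra.
  apply: le_trans; rewrite -[X in X <= _]mul1r ler_wpM2r//; lra.
- by move/andP: c01 => [? ?]; rewrite ger0_norm.
Qed.

End Comparison.

Local Open Scope classical_set_scope.
Local Open Scope ring_scope.

(** * Product measures on tuples *)

(** Bundles the pushforward with its measurability proof, so that it can be passed where a measure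
    structure is expected. *)
Definition push_measure d d' (T1 : measurableType d) (T2 : measurableType d')
  (R : realFieldType) (m : {measure set T1 -> \bar R}) (f : T1 -> T2)
  (mf : measurable_fun setT f) : {measure set T2 -> \bar R} :=
  measure_function_pushforward__canonical__measure_function_Measure m mf.

Section TupleBoxes.
Context d (T : measurableType d) (R : realType).

Definition tuple_box n (B : 'I_n -> set T) : set (n.-tuple T) :=
  [set t | forall i, B i (tnth t i)].

Lemma measurable_tuple_box n (B : 'I_n -> set T) :
  (forall i, measurable (B i)) -> measurable (tuple_box B).
Proof.
move=> mB; rewrite [X in measurable X](_ : _ =
    \bigcap_(i in [set: 'I_n]) ((@tnth n T)^~ i @^-1` B i)); last first.
  by apply/seteqP; split=> [t tB i _|t tB i]; exact: tB.
apply: fin_bigcap_measurable => [|i _]; first exact: finite_finset.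
by rewrite -[X in measurable X]setTI; exact: (measurable_tnth i measurableT (mB i)).
Qed.

Definition tuple_boxes n : set (set (n.-tuple T)) :=
  [set A | exists2 B : 'I_n -> set T,
    (forall i, measurable (B i)) & A = tuple_box B].

Lemma measurable_tuple_boxesE n :
  @measurable _ (n.-tuple T) = <<s @tuple_boxes n >>.
Proof.
apply/seteqP; split; last first.
  apply: smallest_sub; first exact: sigma_algebra_measurable.
  by move=> _ [B mB ->]; exact: measurable_tuple_box.
apply: smallest_sub; first exact: smallest_sigma_algebra.
move=> A; rewrite -bigcup_seq/= => -[i _ [B mB <-]].
apply: sub_sigma_algebra; exists (fun j => if j == i then B else setT).
  by move=> j; case: ifP.
rewrite setTI; apply/seteqP; split=> t /=.
  by move=> Bt j; case: eqP => [->|].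
by move=> /(_ i); rewrite eqxx.
Qed.

(** Boxes form a generating pi-system containing the whole space. The laws of tuples below are
    identified this way. *)
Lemma measure_tuple_unique n (m1 m2 : {measure set (n.-tuple T) -> \bar R}) :
  (m1 setT < +oo)%E ->
  (forall B : 'I_n -> set T, (forall i, measurable (B i)) ->
     m1 (tuple_box B) = m2 (tuple_box B)) ->
  forall A, measurable A -> m1 A = m2 A.
Proof.
move=> m1T m12 A mA.
apply: (measure_unique (@tuple_boxes n) (fun=> setT)) => //.
- exact: measurable_tuple_boxesE.
- move=> _ _ [B mB ->] [C mC ->]; exists (fun i => B i `&` C i).
    by move=> i; exact: measurableI.
  apply/seteqP; split=> t /=; first by move=> [Bt Ct] i; split.
  by move=> BC; split=> i; case: (BC i).
- by move=> _; exists (fun=> setT) => //; apply/seteqP; split.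
- by apply/seteqP; split=> // x _; exists 0%N.
- by move=> _ [B mB ->]; exact: m12.
Qed.

Variable lam : {finite_measure set T -> \bar R}.
Let mass := fine (lam setT).
Local Notation Lam := (power_measure lam).

Lemma power_measure_boxE n (B : 'I_n -> set T) :
  (forall i, measurable (B i)) ->
  Lam n (tuple_box B) = (\prod_(i < n) fine (lam (B i)))%:E.
Proof. exact: power_measure_box. Qed.

Lemma power_measure_setT n : Lam n setT = (mass ^+ n)%:E.
Proof.
rewrite (_ : setT = tuple_box (fun _ : 'I_n => setT)).
  by rewrite power_measure_boxE// prodr_const card_ord.
by apply/seteqP; split.
Qed.

Lemma power_measure_fin n A : measurable A -> Lam n A \is a fin_num.
Proof. by move=> mA; exact: fin_num_measure. Qed.

Definition cat_pair a b (xy : a.-tuple T * b.-tuple T) : (a + b).-tuple T :=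
  [tuple of xy.1 ++ xy.2].

Lemma measurable_cat_pair a b : measurable_fun setT (@cat_pair a b).
Proof.
apply/measurable_fun_tnthP => i; case: (split_ordP i) => j ->.
  rewrite (_ : _ \o _ = (@tnth a T)^~ j \o fst).
    by apply: (measurableT_comp (measurable_tnth j)); exact: measurable_fst.
  by apply/funext => -[x y] /=; rewrite tnth_lshift.
rewrite (_ : _ \o _ = (@tnth b T)^~ j \o snd).
  by apply: (measurableT_comp (measurable_tnth j)); exact: measurable_snd.
by apply/funext => -[x y] /=; rewrite tnth_rshift.
Qed.

Lemma power_measure_cat a b (A : set ((a + b).-tuple T)) : measurable A ->
  Lam (a + b)%N A = (Lam a \x Lam b)%E (@cat_pair a b @^-1` A).
Proof.
move=> mA; pose m2 := push_measure (Lam a \x Lam b)%E (@measurable_cat_pair a b).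
rewrite -[RHS]/(m2 A); apply: measure_tuple_unique => //.
  by rewrite -ge0_fin_numE//; exact: power_measure_fin.
move=> B mB; rewrite [LHS](power_measure_boxE mB) /m2 /= /pushforward.
rewrite (_ : _ @^-1` _ = tuple_box (fun i => B (lshift b i)) `*`
                         tuple_box (fun i => B (rshift a i))); last first.
  apply/seteqP; split=> -[x y] /=.
    move=> xyB; split=> i.
    - by have := xyB (lshift b i); rewrite /cat_pair tnth_lshift.
    - by have := xyB (rshift a i); rewrite /cat_pair tnth_rshift.
  move=> [xB yB] i; rewrite /cat_pair/=.
  by case: (split_ordP i) => j ->; rewrite ?tnth_lshift ?tnth_rshift.
rewrite product_measure1E//; try exact: measurable_tuple_box.
rewrite [X in (X * _)%E](power_measure_boxE (fun i => mB (lshift b i))).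
rewrite [X in (_ * X)%E](power_measure_boxE (fun i => mB (rshift a i))).
by rewrite big_split_ord EFinM.
Qed.

Definition sel_tuple n m (s : m.-tuple 'I_n) (x : n.-tuple T) : m.-tuple T :=
  map_tuple (tnth x) s.

Lemma measurable_sel_tuple n m (s : m.-tuple 'I_n) :
  measurable_fun setT (sel_tuple s).
Proof.
apply/measurable_fun_tnthP => i.
rewrite (_ : _ \o _ = (@tnth n T)^~ (tnth s i)); first exact: measurable_tnth.
by apply/funext => x /=; rewrite tnth_map.
Qed.

(** Each coordinate that is not selected integrates to [mass]. With m = n this is exchangeability;
    otherwise it evaluates events that depend on few coordinates. *)
Lemma power_measure_sel n m (s : m.-tuple 'I_n) (A : set (m.-tuple T)) :
  uniq s -> measurable A ->
  Lam n (sel_tuple s @^-1` A) = ((mass ^+ (n - m))%:E * Lam m A)%E.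
Proof.
move=> us mA.
have mass0 : 0 <= mass ^+ (n - m) by rewrite exprn_ge0// fine_ge0.
pose m1 := push_measure (Lam n) (measurable_sel_tuple s).
pose m2 : {measure set (m.-tuple T) -> \bar R} := mscale (NngNum mass0) (Lam m).
rewrite -[LHS]/(m1 A) -[RHS]/(m2 A); apply: measure_tuple_unique => //.
  rewrite /m1 /= /pushforward preimage_setT -ge0_fin_numE//.
  exact: power_measure_fin.
move=> B mB; rewrite /m1 /m2 /= /mscale /= /pushforward.
rewrite [X in _ = (_ * X)%E](power_measure_boxE mB).
(* The constraint on coordinate j: [B i] if j is the i-th selected index, none if j is not
   selected. *)
pose C (j : 'I_n) := if insub (index j s) is Some i then B i else setT.
have CE i : C (tnth s i) = B i.
  rewrite /C; have si : index (tnth s i) s = i.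
    by rewrite (tnth_nth (tnth s i)) index_uniq// size_tuple.
  by rewrite si valK.
have CN j : j \notin tval s -> C j = setT.
  move=> js; rewrite /C insubF// -[X in (_ < X)%N](size_tuple s) index_mem.
  exact: negbTE.
rewrite (_ : _ @^-1` _ = tuple_box C); last first.
  apply/seteqP; split=> x /=.
    move=> xB j; have [/tnthP[i ->]|/CN->//] := boolP (j \in tval s).
    by rewrite CE; have := xB i; rewrite tnth_map.
  by move=> xC i; rewrite tnth_map -CE; exact: xC.
have mC j : measurable (C j) by rewrite /C; case: insubP.
rewrite [LHS](power_measure_boxE mC).
rewrite -EFinM; congr (_%:E); rewrite (bigID (mem (tval s)))/= mulrC; congr (_ * _).
  rewrite (eq_bigr (fun=> mass)) => [|j js]; last by rewrite CN.
  rewrite prodr_const; congr (_ ^+ _).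
  have := cardC (mem (tval s)); rewrite card_ord (card_uniqP us) size_tuple.
  by move=> /(congr1 (subn^~ m)); rewrite addKn => <-; apply: eq_card.
rewrite -big_uniq//= big_tuple; apply: eq_bigr => i _.
by rewrite CE.
Qed.

End TupleBoxes.

(** * Measurability on configurations *)

Section NatValued.
Context d (X : measurableType d).

Lemma measurable_natP (f : X -> nat) :
  (forall m, measurable (f @^-1` [set m])) -> measurable_fun setT f.
Proof.
move=> mf _ Y _; rewrite setTI (_ : f @^-1` Y = \bigcup_(m in Y) f @^-1` [set m]).
  by apply: bigcup_measurable => m _.
by apply/seteqP; split=> [x Yx|x [m Ym /= fm]]; [exists (f x)|rewrite /= fm].
Qed.

Lemma measurable_nat_preimage (f : X -> nat) Y :
  measurable_fun setT f -> measurable (f @^-1` Y).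
Proof. by move=> mf; rewrite -[X in measurable X]setTI; exact: mf. Qed.

Lemma measurable_nat2 (op : nat -> nat -> nat) (f g : X -> nat) :
  measurable_fun setT f -> measurable_fun setT g ->
  measurable_fun setT (fun x => op (f x) (g x)).
Proof.
move=> mf mg; apply: measurable_natP => m.
rewrite (_ : _ @^-1` _ = \bigcup_a \bigcup_(b in [set b | op a b = m])
    (f @^-1` [set a] `&` g @^-1` [set b])).
  apply: bigcup_measurable => a _; apply: bigcup_measurable => b _.
  by apply: measurableI; exact: measurable_nat_preimage.
apply/seteqP; split=> x /=.
  by move=> fgm; exists (f x) => //; exists (g x).
by move=> [a _ [b /= abm [/= -> ->]]].
Qed.

Lemma measurable_nat_sup (f : X -> nat) (F : nat -> X -> nat) :
  (forall n, measurable_fun setT (F n)) ->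
  (forall n x, (F n x <= f x)%N) -> (forall x, exists n, F n x = f x) ->
  measurable_fun setT f.
Proof.
move=> mF Ff fF.
have mle m : measurable [set x | (f x <= m)%N].
  rewrite (_ : mkset _ = \bigcap_n (F n @^-1` [set j | (j <= m)%N])).
    by apply: bigcap_measurable => // n _; exact: measurable_nat_preimage.
  apply/seteqP; split=> x /=; first by move=> fm n _ /=; exact: leq_trans (Ff n x) fm.
  by move=> Fm; have [n <-] := fF x; exact: Fm.
apply: measurable_natP => -[|m].
  rewrite (_ : _ @^-1` _ = [set x | (f x <= 0)%N]) //.
  by apply/seteqP; split=> x /=; [move->|rewrite leqn0 => /eqP].
rewrite (_ : _ @^-1` _ = [set x | (f x <= m.+1)%N] `\` [set x | (f x <= m)%N]).
  exact: measurableD.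
apply/seteqP; split=> x /=; first by move=> ->; split=> //; rewrite ltnn.
by move=> [fm /negP]; rewrite -ltnNge => mf; apply/eqP; rewrite eqn_leq fm mf.
Qed.

End NatValued.

Section ConfigMeasurability.
Context d (T : measurableType d).
Implicit Types (xi : config T) (B : set T).

Lemma count_inE (xi : {fset T}) B : count_in xi B = count [in B] xi.
Proof.
rewrite -size_filter /count_in; apply: perm_size; apply: uniq_perm.
- exact: fset_uniq.
- by rewrite filter_uniq.
- by move=> x; rewrite !inE mem_filter andbC.
Qed.

Lemma count_in_fset (s : seq T) B :
  uniq s -> count_in [fset x in s]%fset B = count [in B] s.
Proof. by move=> us; rewrite count_inE; apply/permP/perm_fset_seq. Qed.

Lemma measurable_count_in B : measurable B ->
  measurable_fun setT (fun xi : config T => count_in xi B).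
Proof.
move=> mB; apply: measurable_natP => m.
by apply: sub_sigma_algebra; exists B, m.
Qed.

(** Finite intersections of the generating events, indexed by lists so that intersection is
    concatenation: a generating pi-system. *)
Definition count_all (L : seq (set T * nat)) : set (config T) :=
  [set xi | all (fun p => count_in xi p.1 == p.2) L].

Definition count_all_events : set (set (config T)) :=
  [set E | exists2 L, (forall p, p \in L -> measurable p.1) & E = count_all L].

Lemma measurable_count_all L : (forall p, p \in L -> measurable p.1) ->
  measurable (count_all L).
Proof.
elim: L => [|p L IHL] mL; first by rewrite (_ : count_all _ = setT)//; apply/seteqP; split.
rewrite (_ : count_all _ = [set xi | count_in xi p.1 = p.2] `&` count_all L).
  apply: measurableI; last by apply: IHL => q qL; apply: mL; rewrite inE qL orbT.
  by apply: sub_sigma_algebra; exists p.1, p.2; split=> //; apply: mL; rewrite mem_head.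
apply/seteqP; split=> xi; rewrite /count_all /=; first by move=> /andP[/eqP].
by move=> [-> ->]; rewrite eqxx.
Qed.

Lemma measurable_configE : @measurable _ (config T) = <<s count_all_events >>.
Proof.
apply/seteqP; split; last first.
  apply: smallest_sub; first exact: sigma_algebra_measurable.
  by move=> _ [L mL ->]; exact: measurable_count_all.
apply: smallest_sub; first exact: smallest_sigma_algebra.
move=> _ [B [m [mB ->]]]; apply: sub_sigma_algebra; exists [:: (B, m)].
  by move=> p; rewrite inE => /eqP ->.
by apply/seteqP; split=> xi; rewrite /count_all /= andbT => /eqP.
Qed.

(** How many k-subsets have the counts prescribed by [L] depends on a configuration only through the
    multiset of colours of its points, and such multisets are countably many. *)
Definition colour (L : seq (set T * nat)) (x : T) : seq bool :=
  [seq x \in p.1 | p <- L].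

Lemma measurable_colour L a : (forall p, p \in L -> measurable p.1) ->
  measurable [set x | colour L x = a].
Proof.
elim: L a => [|p L IHL] a mL.
  have [->|an] := eqVneq a [::].
    by rewrite (_ : mkset _ = setT)//; apply/seteqP; split.
  rewrite (_ : mkset _ = set0)//; apply/seteqP; split=> // x /= /esym a0.
  by rewrite a0 eqxx in an.
case: a => [|b a]; first by rewrite (_ : mkset _ = set0)//; apply/seteqP; split.
have mp : measurable p.1 by apply: mL; rewrite mem_head.
have mL' q : q \in L -> measurable q.1.
  by move=> qL; apply: mL; rewrite inE qL orbT.
rewrite (_ : mkset _ = (if b then p.1 else ~` p.1) `&` [set x | colour L x = a]).
  by apply: measurableI; [case: b => //; exact: measurableC | exact: IHL].
apply/seteqP; split=> x /=.
  by move=> [<- ->]; split=> //; case: ifPn => [/set_mem//|/negP xp px]; apply: xp; exact: mem_set.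
case: b => -[px ->]; congr (_ :: _); first exact: mem_set.
by apply/negP => /set_mem.
Qed.

Lemma measurable_perm_colour L (l : seq (seq bool)) :
  (forall p, p \in L -> measurable p.1) ->
  measurable [set xi : config T | perm_eq (map (colour L) xi) l].
Proof.
move=> mL.
pose D (a : seq bool) := [set xi : config T |
  count_in xi [set x | colour L x = a] = count_mem a l].
have mD a : measurable (D a).
  apply: (measurable_nat_preimage [set count_mem a l]).
  by apply: measurable_count_in; exact: measurable_colour.
rewrite (_ : mkset _ = \bigcap_n (oapp D setT (choice.unpickle n))).
  by apply: bigcap_measurable => // n _; exact: mD.
have cE a (xi : config T) :
    count_in xi [set x | colour L x = a] = count_mem a (map (colour L) xi).
  rewrite count_inE count_map; apply: eq_count => x /=.
  by apply/idP/eqP => [/set_mem//|?]; exact/mem_set.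
apply/seteqP; split=> xi /=.
  by move=> /permP xil n _; rewrite /D /= cE.
move=> xiD; rewrite /perm_eq; apply/allP => a _ /=; apply/eqP.
have : oapp D setT (choice.unpickle (choice.pickle a)) xi by exact: xiD.
by rewrite choice.pickleK /D /= cE.
Qed.

Definition count_subsets k (E : set (config T)) (xi : config T) : nat :=
  \sum_(t <- subs k (xi : {fset T})) (([fset x in t]%fset : config T) \in E).

Lemma measurable_count_subsets_all k L : (forall p, p \in L -> measurable p.1) ->
  measurable_fun setT (count_subsets k (count_all L)).
Proof.
move=> mL.
pose ok (t : seq (seq bool)) : bool := all (fun i =>
  count (fun b : seq bool => nth false b i) t == nth 0%N (map snd L) i) (iota 0 (size L)).
pose G (l : seq (seq bool)) := (\sum_(t <- subs k l) ok t)%N.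
have okP t t' : perm_eq t t' -> ok t = ok t' :> nat.
  move=> /permP tt'; congr nat_of_bool; apply: eq_all => i /=.
  by rewrite tt'.
have GP l l' : perm_eq l l' -> G l = G l'.
  by move=> ll'; apply: big_subs_perm => //.
have FG xi : count_subsets k (count_all L) xi = G (map (colour L) xi).
  rewrite /G map_subs big_map /count_subsets !big_seq.
  apply: eq_bigr => t; rewrite mem_subs => /andP[txi _]; congr nat_of_bool.
  have ut : uniq t by apply: subseq_uniq txi _; exact: fset_uniq.
  apply/idP/idP.
    move=> /set_mem; rewrite /count_all /= => /(all_nthP (set0, 0%N)) tL.
    apply/allP => i; rewrite mem_iota => /andP[_ iL].
    rewrite (nth_map (set0, 0%N))// -(eqP (tL _ iL)) count_in_fset// count_map.
    by apply/eqP/eq_count => x /=; rewrite /colour (nth_map (set0, 0%N)).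
  move=> /allP tok; apply/mem_set; rewrite /count_all /=.
  apply/(all_nthP (set0, 0%N)) => i iL; rewrite count_in_fset//.
  have := tok i; rewrite mem_iota => /(_ iL).
  rewrite (nth_map (set0, 0%N))// count_map => /eqP <-.
  by apply/eqP/eq_count => x /=; rewrite /colour (nth_map (set0, 0%N)).
have [p [e pK]] : exists p (e : nat -> option (seq (seq bool))),
    forall l, e (p l) = Some l.
  by exists choice.pickle, choice.unpickle; exact: choice.pickleK.
apply: measurable_natP => m.
rewrite (_ : _ @^-1` _ = \bigcup_(n in [set n | (exists2 l, e n = Some l & G l = m)])
  [set xi : config T | perm_eq (map (colour L) xi) (odflt [::] (e n))]).
  by apply: bigcup_measurable => n _; exact: measurable_perm_colour.
apply/seteqP; split=> xi /=; rewrite FG.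
  move=> xim; exists (p (map (colour L) xi)) => /=; rewrite pK//=.
  by exists (map (colour L) xi).
by move=> [n /= [l -> <-]] /=; exact: GP.
Qed.

(** Dynkin argument: the count turns proper differences of events into differences of counts,
    increasing unions into suprema, and is measurable on the pi-system [count_all_events]. *)
Lemma measurable_count_subsets k (E : set (config T)) : measurable E ->
  measurable_fun setT (count_subsets k E).
Proof.
move=> mE.
pose H : set (set (config T)) := [set E | measurable_fun setT (count_subsets k E)].
suff : measurable `<=` H by apply.
rewrite measurable_configE; apply: lambda_system_subset.
- move=> _ _ [L mL ->] [L' mL' ->]; exists (L ++ L').
    by move=> p; rewrite mem_cat => /orP[/mL|/mL'].
  apply/seteqP; split=> xi; rewrite /count_all /= all_cat; first by move=> [-> ->].
  by move=> /andP.
- split=> //.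
  + have := @measurable_count_subsets_all k [::]; rewrite /H /= => /(_ _).
    by rewrite (_ : count_all [::] = setT)//; [exact|apply/seteqP; split].
  + move=> A B AB HA HB; rewrite /H /=.
    rewrite (_ : count_subsets k _ =
        fun xi => (count_subsets k A xi - count_subsets k B xi)%N).
      exact: (measurable_nat2 subn).
    apply/funext => xi; rewrite /count_subsets -sumnB.
      apply: eq_bigr => t _; rewrite in_setD.
      by case: (boolP (_ \in B)) => [/set_mem/AB/mem_set->|]; rewrite ?andbT ?andbF ?subn0.
    by move=> t _; case: (boolP (_ \in B)) => // /set_mem/AB/mem_set->.
  + move=> F ndF HF; rewrite /H /=.
    have le n A (xi : config T) : (count_subsets k (F n) xi <= count_subsets k (\bigcup_i F i) xi)%N.
      apply: leq_sum => t _; case: (boolP (_ \in F n)) => // /set_mem tF.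
      by rewrite mem_set//; exists n.
    apply: (@measurable_nat_sup _ _ _ (fun n => count_subsets k (F n))) => //.
      by move=> n xi; exact: le.
    move=> xi; rewrite /count_subsets.
    (* A configuration has finitely many k-subsets, so a single index captures all those lying in
       the union; the supremum is attained. *)
    suff [n nP] : exists n, forall t, t \in subs k (xi : {fset T}) ->
        (([fset x in t]%fset : config T) \in \bigcup_i F i) ->
        ([fset x in t]%fset : config T) \in F n.
      exists n; rewrite big_seq [RHS]big_seq; apply: eq_bigr => t tr.
      congr nat_of_bool; apply/idP/idP => [/set_mem tF|]; last exact: nP.
      by apply/mem_set; exists n.
    elim: (subs k _) => [|t r [n IHn]]; first by exists 0%N.
    have [[m _ tF]|tF] := pselect ((\bigcup_i F i) ([fset x in t]%fset : config T)).
      exists (maxn n m) => u; rewrite inE => /predU1P[->{u} _|ur /(IHn _ ur)/set_mem uF].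
        by apply/mem_set; move/subsetPset: (ndF _ _ (leq_maxr n m)); exact.
      by apply/mem_set; move/subsetPset: (ndF _ _ (leq_maxl n m)); exact.
    exists n => u; rewrite inE => /predU1P[->{u} /set_mem//|ur]; exact: IHn.
- by move=> _ [L mL ->]; exact: measurable_count_subsets_all.
- by move=> X _ x _.
Qed.

End ConfigMeasurability.

(** * U-statistics *)

Section SymmetricKernel.
Context d (T : measurableType d).
Variables (A : set (T * T)) (k : nat) (h : config T -> bool).

(** Both orders are excluded because [A] need not be symmetric, while the kernel must be invariant
    under permutations. *)
Definition off_diag (x y : T) : bool := ((x, y) \notin A) && ((y, x) \notin A).

(* A is a null set containing the diagonal. Unlike on_points k h, this version of
   the kernel is measurable on tuples. *)
Definition kernel_seq (s : seq T) : bool :=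
  [&& size s == k, pairwise off_diag s & h [fset x in s]%fset].

Definition ustat (s : seq T) : nat := \sum_(t <- subs k s) kernel_seq t.

Hypothesis Adiag : forall x, A (x, x).

Lemma off_diag_uniq s : pairwise off_diag s -> uniq s.
Proof.
rewrite uniq_pairwise; apply: sub_pairwise => x y /andP[xA _].
by apply: contraNneq xA => ->; exact/mem_set.
Qed.

Lemma off_diag_perm s s' : perm_eq s s' ->
  pairwise off_diag s = pairwise off_diag s'.
Proof.
suff imp t t' : perm_eq t t' -> pairwise off_diag t -> pairwise off_diag t'.
  by move=> ss'; apply/idP/idP; apply: imp; rewrite // perm_sym.
have off_sym x y : off_diag x y = off_diag y x by rewrite /off_diag andbC.
elim: t t' => [|x t IHt] t'; first by rewrite perm_sym => /perm_size/size0nil->.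
move=> tt'; have xt' : x \in t' by rewrite -(perm_mem tt') mem_head.
case/splitPr: xt' tt' => s1 s2.
rewrite perm_sym -cat1s perm_catCA perm_cons perm_sym => tt'.
rewrite /= => /andP[xt /(IHt _ tt')].
have : all (off_diag x) (s1 ++ s2) by rewrite -(perm_all _ tt').
rewrite all_cat !pairwise_cat => /andP[xs1 xs2] /and3P[s12 -> ps2].
rewrite /= xs2 ps2 !andbT /allrel; apply/allP => y ys1 /=.
by rewrite off_sym (allP xs1)//; exact: (allP s12).
Qed.

Lemma kernel_seq_perm s s' : perm_eq s s' -> kernel_seq s = kernel_seq s'.
Proof.
move=> ss'; rewrite /kernel_seq (perm_size ss') (off_diag_perm ss').
suff -> : [fset x in s]%fset = [fset x in s']%fset :> {fset T} by [].
by apply/fsetP => x; rewrite !inE (perm_mem ss').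
Qed.

Lemma ustat_perm s s' : perm_eq s s' -> ustat s = ustat s'.
Proof.
by move=> ss'; apply: big_subs_perm => // t t' tt'; rewrite (kernel_seq_perm tt').
Qed.

(** The comparison through which [gamma] enters: a pointwise inequality, valid although the right
    side may fail to be measurable. *)
Lemma kernel_seq_on_points s : kernel_seq s -> on_points k h s.
Proof.
move=> /and3P[sk /off_diag_uniq us hs].
by rewrite /on_points card_fset_uniq// sk.
Qed.

Lemma subset_count_seq s : uniq s -> subset_count k h [fset x in s]%fset =
  (\sum_(t <- subs k s) h [fset x in t]%fset)%N.
Proof.
by move=> us; rewrite -(big_fpowerset_card (fun psi => h psi : nat) k us).
Qed.

Lemma subset_count_off_diag s : pairwise off_diag s ->
  subset_count k h [fset x in s]%fset = ustat s.
Proof.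
move=> ps; have us := off_diag_uniq ps.
rewrite subset_count_seq//.
rewrite /ustat big_seq [RHS]big_seq; apply: eq_bigr => t; rewrite mem_subs => /andP[ts tk].
by rewrite /kernel_seq tk (subseq_pairwise ts ps).
Qed.

Lemma subset_countE (xi : config T) : subset_count k h xi =
  count_subsets k (config_card k `&` [set psi | h psi]) xi.
Proof.
pose s : seq T := enum_fset xi.
transitivity (subset_count k h [fset x in s]%fset).
  by congr (subset_count k h _); apply/fsetP => x; rewrite !inE.
rewrite subset_count_seq; last exact: fset_uniq.
rewrite /count_subsets big_seq [RHS]big_seq; apply: eq_bigr => t.
rewrite mem_subs => /andP[/subseq_uniq/(_ (fset_uniq _)) ut /eqP tk].
congr nat_of_bool; apply/idP/idP => [ht|/set_mem[]//].
by apply/mem_set; split=> //=; rewrite /config_card /= card_fset_uniq.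
Qed.

Hypotheses (mA : measurable A) (mh : measurable_fun (config_card k) h).

Lemma measurable_kernel_card : measurable (config_card k `&` [set psi | h psi]).
Proof.
have := mh (measurable_config_card k) (_ : measurable [set true]).
by rewrite (_ : h @^-1` [set true] = [set psi | h psi])//; exact.
Qed.

Lemma measurable_subset_count : measurable_fun setT (subset_count k h).
Proof.
rewrite (_ : subset_count k h = count_subsets k (config_card k `&` [set psi | h psi])).
  by apply: measurable_count_subsets; exact: measurable_kernel_card.
by apply/funext => xi; exact: subset_countE.
Qed.

Lemma measurable_tnth_pair n (i j : 'I_n) (B : set (T * T)) : measurable B ->
  measurable [set x : n.-tuple T | B (tnth x i, tnth x j)].
Proof.
have m2 : measurable_fun setT (fun x : n.-tuple T => (tnth x i, tnth x j)).
  by apply: measurable_fun_pair; exact: measurable_tnth.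
by move=> mB; rewrite -[X in measurable X]setTI; exact: m2.
Qed.

Lemma measurable_off_diag n : measurable [set x : n.-tuple T | pairwise off_diag x].
Proof.
rewrite (_ : mkset _ = \bigcap_(ij in [set ij : 'I_n * 'I_n | (ij.1 < ij.2)%N])
  ([set x : n.-tuple T | (~` A) (tnth x ij.1, tnth x ij.2)] `&`
   [set x : n.-tuple T | (~` A) (tnth x ij.2, tnth x ij.1)])).
  apply: fin_bigcap_measurable => [|[i j] _]; first exact: finite_finset.
  by apply: measurableI; apply: measurable_tnth_pair; exact: measurableC.
have offP x y : off_diag x y <-> ((~` A) (x, y) /\ (~` A) (y, x)).
  rewrite /off_diag; split; first by move=> /andP[/negP xy /negP yx]; split=> /mem_set.
  by move=> [xy yx]; apply/andP; split; apply/negP => /set_mem.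
apply/seteqP; split=> x /=.
  move=> /(pairwiseP point) xP [i j] /= ij; apply/offP.
  rewrite !(tnth_nth point); apply: xP => //; rewrite inE size_tuple; exact: ltn_ord.
move=> xP; apply/(pairwiseP point) => i j; rewrite !inE size_tuple => iN jN ij.
have [] := xP (Ordinal iN, Ordinal jN) ij; rewrite /= !(tnth_nth point) /=.
by move=> ? ?; apply/offP.
Qed.

(** The map from a tuple to its set of points is shown measurable on the off-diagonal tuples: there
    the points are distinct, so the count in B is the sum of the indicators of B at the
    coordinates. *)
Lemma measurable_kernel_tuple n : measurable [set x : n.-tuple T | kernel_seq x].
Proof.
have [nk|nk] := eqVneq n k; last first.
  rewrite (_ : mkset _ = set0)//; apply/seteqP; split=> // x /=.
  by rewrite /kernel_seq size_tuple (negbTE nk).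
pose D := [set x : n.-tuple T | pairwise off_diag x].
pose phi (x : n.-tuple T) : config T := [fset y in tval x]%fset.
have mphi : measurable_fun D phi.
  apply: (@measurability _ _ _ (config T: measurableType _) D phi (count_events (T:=T))) => //.
  move=> _ [_ [B [m [mB ->]]] <-].
  rewrite (_ : _ `&` _ = D `&` [set x | (\sum_(i < n) (tnth x i \in B))%N = m]).
    apply: measurableI; first exact: measurable_off_diag.
    suff mf : measurable_fun setT (fun x : n.-tuple T => \sum_(i < n) (tnth x i \in B))%N.
      exact: (measurable_nat_preimage [set m] mf).
    elim: (index_enum _) => [|i r IHr].
      by under eq_fun do rewrite big_nil; exact: measurable_cst.
    under eq_fun do rewrite big_cons; apply: (measurable_nat2 addn) => //.
    apply: measurable_natP => j.
    rewrite (_ : _ @^-1` _ = (@tnth n T)^~ i @^-1` [set y | (y \in B) = j :> nat])//.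
    rewrite -[X in measurable X]setTI; apply: measurable_tnth => //.
    case: j => [|[|j]].
    - rewrite (_ : mkset _ = ~` B); first exact: measurableC.
      apply/seteqP; split=> y /=; first by case: (boolP (y \in B)) => // /negP yB _ /mem_set.
      by move=> yB; case: (boolP (y \in B)) => // /set_mem.
    - rewrite (_ : mkset _ = B)//.
      apply/seteqP; split=> y /=; first by case: (boolP (y \in B)) => // /set_mem.
      by move/mem_set ->.
    - rewrite (_ : mkset _ = set0)//.
      by apply/seteqP; split=> y //=; case: (y \in B).
  have cE (x : n.-tuple T) : count [in B] x = (\sum_(i < n) (tnth x i \in B))%N.
    by rewrite -sum1_count big_mkcond big_tuple; apply: eq_bigr => i _ /=; case: ifP.
  by apply/seteqP; split=> x [Dx] /=; rewrite /phi count_in_fset ?(off_diag_uniq Dx)// cE.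
have xk (x : n.-tuple T) : size x == k by rewrite size_tuple; exact/eqP.
have mhphi : measurable_fun D (h \o phi).
  apply: (@measurable_comp _ _ _ _ _ _ (config_card k)) => //.
    exact: measurable_config_card.
  move=> _ [x Dx <-]; rewrite /config_card /= card_fset_uniq ?size_tuple//.
  exact: off_diag_uniq.
have := mhphi (@measurable_off_diag n) [set true] I.
rewrite (_ : mkset _ = D `&` (h \o phi) @^-1` [set true])//.
by apply/seteqP; split=> x; rewrite /= /kernel_seq xk /=; [move=> /andP|move=> [? ?]; apply/andP].
Qed.

End SymmetricKernel.

(** * Inequalities between measures from pointwise counting *)

Section MeasureTools.
Context d (X : measurableType d) (R : realType).
Variable m : {measure set X -> \bar R}.

(** The integral of a nonnegative function is a supremum over simple functions below it, so
    monotonicity holds without measurability, as the integrands of [gamma] demand. *)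
Lemma ge0_le_integral_nonmeas (f g : X -> \bar R) :
  (forall x, 0 <= f x)%E -> (forall x, f x <= g x)%E ->
  (\int[m]_x f x <= \int[m]_x g x)%E.
Proof.
move=> f0 fg; have g0 x : (0 <= g x)%E by exact: le_trans (fg x).
rewrite !ge0_integralTE//; apply: le_ereal_sup => _ [u uf <-].
by exists u => // x; exact: le_trans (uf x) (fg x).
Qed.

Lemma sum_measure_le (I J : Type) (r : seq I) (s : seq J)
    (D : I -> set X) (E : J -> set X) :
  (forall i, measurable (D i)) -> (forall j, measurable (E j)) ->
  (forall x, \sum_(i <- r) (x \in D i) <= \sum_(j <- s) (x \in E j))%N ->
  (\sum_(i <- r) m (D i) <= \sum_(j <- s) m (E j))%E.
Proof.
have mind (K : Type) (G : K -> set X) (t : seq K) : (forall k, measurable (G k)) ->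
    (\sum_(k <- t) m (G k) = \int[m]_x (\sum_(k <- t) (\1_(G k) x)%:E))%E.
  move=> mG; rewrite ge0_integral_sum//.
  - by apply: eq_bigr => k _; rewrite integral_indic// setIT.
  - by move=> k; apply/measurable_EFinP; exact: measurable_indic.
have sind (K : Type) (G : K -> set X) (t : seq K) x :
    (\sum_(k <- t) (\1_(G k) x)%:E = (\sum_(k <- t) (x \in G k))%N%:R%:E :> \bar R)%E.
  rewrite sumEFin natr_sum; congr (_%:E); exact: eq_bigr.
move=> mD mE rs; rewrite !mind//; apply: ge0_le_integral_nonmeas => x.
  by rewrite sind lee_fin.
by rewrite !sind lee_fin ler_nat.
Qed.

Lemma sum_measure_eq (I J : Type) (r : seq I) (s : seq J)
    (D : I -> set X) (E : J -> set X) :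
  (forall i, measurable (D i)) -> (forall j, measurable (E j)) ->
  (forall x, \sum_(i <- r) (x \in D i) = \sum_(j <- s) (x \in E j))%N ->
  (\sum_(i <- r) m (D i) = \sum_(j <- s) m (E j))%E.
Proof.
move=> mD mE rs; apply/eqP; rewrite eq_le; apply/andP.
by split; apply: sum_measure_le => // x; rewrite rs.
Qed.

End MeasureTools.

(** * Kernel events under product measures *)

Section KernelMeasures.
Context d (T : measurableType d) (R : realType).
Variables (A : set (T * T)) (k : nat) (h : config T -> bool).
Hypotheses (Adiag : forall x, A (x, x)) (mA : measurable A).
Hypothesis mh : measurable_fun (config_card k) h.
Variable lam : {finite_measure set T -> \bar R}.
Let mass := fine (lam setT).
Local Notation Lam := (power_measure lam).
Local Notation ker := (kernel_seq A k h).
Local Notation U := (ustat A k h).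

Lemma measurable_kernel_sel n (r : seq 'I_n) :
  measurable [set x : n.-tuple T | ker (map (tnth x) r)].
Proof.
rewrite (_ : mkset _ = sel_tuple (in_tuple r) @^-1` [set x | ker x])//.
rewrite -[X in measurable X]setTI; apply: measurable_sel_tuple => //.
exact: measurable_kernel_tuple.
Qed.

Lemma measurable_nat_bool n (b : n.-tuple T -> bool) :
  measurable [set x | b x] -> measurable_fun setT (fun x => nat_of_bool (b x)).
Proof.
move=> mb; apply: measurable_natP => -[|[|j]].
- rewrite (_ : _ @^-1` _ = ~` [set x | b x]); first exact: measurableC.
  by apply/seteqP; split=> x /=; case: (b x).
- rewrite (_ : _ @^-1` _ = [set x | b x])//.
  by apply/seteqP; split=> x /=; case: (b x).
- rewrite (_ : _ @^-1` _ = set0)//.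
  by apply/seteqP; split=> x //=; case: (b x).
Qed.

Lemma measurable_ustat_sel n (r : seq 'I_n) :
  measurable_fun setT (fun x : n.-tuple T => U (map (tnth x) r)).
Proof.
rewrite (_ : (fun _ => _) = (fun x : n.-tuple T =>
    \sum_(t <- subs k r) ker (map (tnth x) t))%N); last first.
  by apply/funext => x; rewrite /ustat map_subs big_map.
elim: (subs k r) => [|t s IHs].
  by under eq_fun do rewrite big_nil; exact: measurable_cst.
under eq_fun do rewrite big_cons; apply: (measurable_nat2 addn) => //.
by apply: measurable_nat_bool => //; exact: measurable_kernel_sel.
Qed.

Lemma measurable_ustat n : measurable_fun setT (fun x : n.-tuple T => U x).
Proof.
have := measurable_ustat_sel (enum 'I_n).
by under eq_fun do rewrite map_tnth_enum.
Qed.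

(** Union bound over pairs of distinct indices, each pair having law lam^2 up to a factor. *)
Lemma power_measure_off_diag n : (lam \x lam)%E A = 0%E ->
  Lam n [set x | ~~ pairwise (off_diag A) x] = 0%E.
Proof.
move=> A0.
pose A2 := [set t : 2.-tuple T | A (tnth t ord0, tnth t ord_max)].
have mA2 : measurable A2 by exact: measurable_tnth_pair.
have Lam2 : Lam 2 A2 = 0%E.
  rewrite -A0 -[LHS]/(pushforward _ _ _) /= /power_step /pushforward.
  apply: eq_integral => x _ /=.
  have mxA : measurable (xsection A x) by exact: measurable_xsection.
  have := power_measure_boxE lam (n := 1) (B := fun=> xsection A x) (fun=> mxA).
  rewrite big_ord1 fineK ?fin_num_measure// => <-.
  congr (power_step _ _ _); apply/seteqP; split=> t.
    move=> /set_mem tA i; apply/mem_set; move: tA.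
    by rewrite /= (ord1 i) !(tnth_nth point).
  move=> /(_ ord0)/set_mem tA; apply/mem_set; move: tA.
  by rewrite /= !(tnth_nth point).
have pairA (i j : 'I_n) : i != j -> Lam n [set x | A (tnth x i, tnth x j)] = 0%E.
  move=> ij; pose s : 2.-tuple 'I_n := [tuple i; j].
  have us : uniq s by rewrite /= inE ij.
  have := power_measure_sel lam us mA2; rewrite Lam2 mule0 => <-.
  by congr (Lam n _).
pose E (ij : 'I_n * 'I_n) := if ij.1 != ij.2 then
  [set x : n.-tuple T | A (tnth x ij.1, tnth x ij.2)] else set0.
apply/eqP; rewrite eq_le measure_ge0 andbT.
pose D (i : unit) := [set x : n.-tuple T | ~~ pairwise (off_diag A) x].
have mD i : measurable (D i).
  rewrite (_ : D i = ~` [set x : n.-tuple T | pairwise (off_diag A) x]).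
    by apply: measurableC; exact: measurable_off_diag.
  by apply/seteqP; split=> x /= /negP.
have mE ij : measurable (E ij).
  by rewrite /E; case: ifP => // _; exact: measurable_tnth_pair.
have := @sum_measure_le _ _ _ (Lam n) _ _ [:: tt] (enum {: 'I_n * 'I_n}) D E mD mE.
rewrite big_seq1 => /(_ _)/le_trans; apply; last first.
  rewrite big1// => -[i j] _; rewrite /E /=; case: ifPn => [ij|]; last by rewrite measure0.
  exact: pairA.
move=> x; rewrite big_seq1; case: (boolP (x \in D tt)) => // /set_mem xD.
rewrite lt0n sum_nat_seq_neq0; apply/hasP; move: xD; rewrite /D /=.
case: (pselect (exists ij, x \in E ij)) => [[ij xij] _|noE].
  by exists ij; rewrite ?mem_enum//= xij.
case/negP; apply/(pairwiseP point) => i j; rewrite !inE size_tuple => iN jN ij.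
have nA (i' j' : 'I_n) : i' != j' -> (tnth x i', tnth x j') \notin A.
  move=> ij'; apply/negP => /set_mem xA; apply: noE; exists (i', j').
  by rewrite /E /= ij'; exact/mem_set.
have ij' : Ordinal iN != Ordinal jN by rewrite -val_eqE /= neq_ltn ij.
rewrite /off_diag -(tnth_nth point x (Ordinal iN)) -(tnth_nth point x (Ordinal jN)).
by rewrite !nA// eq_sym.
Qed.

End KernelMeasures.

(** * Exchangeability and splitting off the last k points *)

Section SplitIndices.
Context d (T : measurableType d) (R : realType).
Variables (A : set (T * T)) (k : nat) (h : config T -> bool).
Hypotheses (Adiag : forall x, A (x, x)) (mA : measurable A).
Hypothesis mh : measurable_fun (config_card k) h.
Variable lam : {finite_measure set T -> \bar R}.
Let mass := fine (lam setT).
Local Notation Lam := (power_measure lam).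
Local Notation ker := (kernel_seq A k h).
Local Notation U := (ustat A k h).

Let mker := measurable_kernel_sel Adiag mA mh.
Let mU := measurable_ustat_sel Adiag mA mh.

Lemma measurable_bool_and n (b c : n.-tuple T -> bool) :
  measurable [set x | b x] -> measurable [set x | c x] ->
  measurable [set x | b x && c x].
Proof.
move=> mb mc; rewrite (_ : mkset _ = [set x | b x] `&` [set x | c x]).
  exact: measurableI.
by apply/seteqP; split=> x /= /andP.
Qed.

Lemma power_measure_perm n (s : n.-tuple 'I_n) B : uniq s -> measurable B ->
  Lam n (sel_tuple s @^-1` B) = Lam n B.
Proof.
by move=> us mB; rewrite (power_measure_sel lam us mB) subnn expr0 mul1e.
Qed.

(** Any k distinct indices extend to a permutation of all indices that puts them first, and [U] does
    not see the permutation. *)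
Lemma power_measure_exch n j (r r' : seq 'I_n) :
  uniq r -> uniq r' -> size r = k -> size r' = k ->
  Lam n [set x | ker (map (tnth x) r) && (j <= U x)%N] =
  Lam n [set x | ker (map (tnth x) r') && (j <= U x)%N].
Proof.
pose B := [set t : n.-tuple T | ker (take k t) && (j <= U t)%N].
have mUn : measurable [set x : n.-tuple T | (j <= U x)%N].
  exact: (measurable_nat_preimage [set i | (j <= i)%N] (measurable_ustat Adiag mA mh (n := n))).
have mB : measurable B.
  apply: measurable_bool_and => //.
  rewrite (_ : mkset _ = [set x | ker (map (tnth x) (take k (enum 'I_n)))])//.
  by apply/seteqP; split=> x /=; rewrite map_take map_tnth_enum.
suff key q : uniq q -> size q = k ->
    Lam n [set x | ker (map (tnth x) q) && (j <= U x)%N] = Lam n B.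
  by move=> ur ur' rk rk'; rewrite !key.
move=> uq qk; pose s := q ++ [seq i <- enum 'I_n | i \notin q].
have ps : perm_eq s (enum 'I_n).
  apply: uniq_perm.
  - rewrite cat_uniq uq filter_uniq ?enum_uniq// andbT.
    by apply/hasPn => i; rewrite mem_filter => /andP[].
  - exact: enum_uniq.
  - by move=> i; rewrite mem_cat mem_filter mem_enum andbT orbN.
have ss : size s == n by rewrite (perm_size ps) size_enum_ord.
have us : uniq (Tuple ss) by rewrite /= (perm_uniq ps) enum_uniq.
rewrite -(power_measure_perm us mB); congr (Lam n _).
apply/seteqP; split=> x; rewrite /B /= map_cat take_size_cat ?size_map// -map_cat;
  by rewrite (ustat_perm _ _ _ (perm_map (tnth x) ps)) map_tnth_enum.
Qed.

Variable m : nat.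

(** In an (m + k)-tuple the first m points play the configuration and the last k the points added to
    it in the Mecke formula. *)
Definition ord_first : seq 'I_(m + k) := map (@lshift m k) (enum 'I_m).
Definition ord_last : seq 'I_(m + k) := map (@rshift m k) (enum 'I_k).

Lemma size_ord_first : size ord_first = m.
Proof. by rewrite size_map size_enum_ord. Qed.

Lemma size_ord_last : size ord_last = k.
Proof. by rewrite size_map size_enum_ord. Qed.

Lemma perm_ord_first_last : perm_eq (ord_first ++ ord_last) (enum 'I_(m + k)).
Proof.
apply: uniq_perm; last 2 first.
- exact: enum_uniq.
- move=> i; rewrite mem_enum mem_cat.
  by case: (split_ordP i) => j ->; rewrite map_f ?mem_enum ?orbT.
rewrite cat_uniq (map_inj_uniq (@lshift_inj _ _)) (map_inj_uniq (@rshift_inj _ _)).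
rewrite !enum_uniq andbT /=; apply/hasPn => _ /mapP[i _ ->].
apply/negP => /mapP[j _ /(congr1 val)/= E]; have := ltn_ord j.
by rewrite -E ltnNge leq_addr.
Qed.

Lemma map_ord_first (x : m.-tuple T) (y : k.-tuple T) :
  map (tnth (cat_pair (x, y))) ord_first = x.
Proof.
rewrite -[RHS]map_tnth_enum -map_comp; apply: eq_map => i /=.
by rewrite /cat_pair tnth_lshift.
Qed.

Lemma map_ord_last (x : m.-tuple T) (y : k.-tuple T) :
  map (tnth (cat_pair (x, y))) ord_last = y.
Proof.
rewrite -[RHS]map_tnth_enum -map_comp; apply: eq_map => i /=.
by rewrite /cat_pair tnth_rshift.
Qed.

Definition ker_last (x : (m + k).-tuple T) : bool := ker (map (tnth x) ord_last).
Definition U_first (x : (m + k).-tuple T) : nat := U (map (tnth x) ord_first).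

Lemma power_measure_first_last j :
  Lam (m + k)%N [set x | ker_last x && (j <= (U_first x).+1)%N] =
  (Lam m [set y | (j <= (U y).+1)%N] * Lam k [set z | ker z])%E.
Proof.
have mS : measurable [set x | ker_last x && (j <= (U_first x).+1)%N].
  apply: measurable_bool_and; first exact: mker.
  exact: (measurable_nat_preimage [set i | (j <= i.+1)%N] (mU _)).
rewrite (power_measure_cat lam mS) -product_measure1E; last 2 first.
- exact: (measurable_nat_preimage [set i | (j <= i.+1)%N] (measurable_ustat Adiag mA mh (n := m))).
- exact: measurable_kernel_tuple.
congr ((_ \x _)%E _); apply/seteqP; split=> -[x y];
  rewrite /= /ker_last /U_first map_ord_first map_ord_last.
  by move=> /andP[].
by move=> [? ?]; apply/andP.
Qed.

Lemma ustat_split (x : (m + k).-tuple T) : (0 < k)%N ->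
  U x = (ker_last x + U_first x + \sum_(1 <= b < k)
    \sum_(r1 <- subs b ord_first) \sum_(r2 <- subs (k - b) ord_last)
      ker (map (tnth x) (r2 ++ r1)))%N.
Proof.
move=> k0.
have -> : U x = U (map (tnth x) (ord_first ++ ord_last)).
  by rewrite (ustat_perm _ _ _ (perm_map (tnth x) perm_ord_first_last)) map_tnth_enum.
rewrite /ustat map_cat big_subs_cat big_nat_recr//= big_ltn// subnn subs0.
rewrite big_seq1 subn0 addnAC; congr (_ + _ + _)%N.
- have lastk : subs k (map (tnth x) ord_last) = [:: map (tnth x) ord_last].
    have := size_subs k (map (tnth x) ord_last); rewrite size_map size_ord_last binn.
    have : map (tnth x) ord_last \in subs k (map (tnth x) ord_last).
      by rewrite mem_subs subseq_refl size_map size_ord_last eqxx.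
    by case: (subs _ _) => // a [|//]; rewrite inE => /eqP ->.
  by rewrite lastk big_seq1.
- by apply: eq_bigr => t _; rewrite subs0 big_seq1 cats0.
apply: eq_bigr => b _; rewrite map_subs big_map; apply: eq_bigr => r1 _.
rewrite map_subs big_map; apply: eq_bigr => r2 _; rewrite -map_cat.
congr nat_of_bool; apply: kernel_seq_perm; apply: perm_map.
by rewrite perm_catC.
Qed.

End SplitIndices.

(** * Pairs of overlapping k-subsets *)

Section GapBound.
Context d (T : measurableType d) (R : realType).
Variables (A : set (T * T)) (k : nat) (h : config T -> bool).
Hypotheses (Adiag : forall x, A (x, x)) (mA : measurable A).
Hypothesis mh : measurable_fun (config_card k) h.
Variable lam : {finite_measure set T -> \bar R}.
Let mass := fine (lam setT).
Local Notation Lam := (power_measure lam).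
Local Notation ker := (kernel_seq A k h).
Local Notation U := (ustat A k h).
Local Notation ker_last := (ker_last A h).
Local Notation U_first := (U_first A h).

Let mker := measurable_kernel_sel Adiag mA mh.
Let mU := measurable_ustat_sel Adiag mA mh.
Let mUx := measurable_ustat Adiag mA mh.

Lemma sume_const (I : Type) (r : seq I) (c : \bar R) : (0 <= c)%E ->
  (\sum_(i <- r) c = (size r)%:R%:E * c)%E.
Proof.
move=> c0; elim: r => [|i r IHr]; first by rewrite big_nil mul0e.
by rewrite big_cons IHr /= -natr1 EFinD ge0_muleDl ?lee_fin// mul1e addeC.
Qed.

Let in_bset (X : Type) (b : X -> bool) x : (x \in [set x | b x]) = b x.
Proof. by apply/idP/idP => [/set_mem|/mem_set]. Qed.

(* a points shared by two k-subsets, followed by b further points of each. *)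
Definition shared_pairs a b : set ((a + (b + b)).-tuple T) :=
  [set t | ker (take a t ++ take b (drop a t)) &&
           ker (take a t ++ drop b (drop a t))].

Arguments shared_pairs : clear implicits.

Lemma measurable_shared_pairs a b : measurable (shared_pairs a b).
Proof.
rewrite (_ : shared_pairs a b = [set t : (a + (b + b)).-tuple T |
    ker (map (tnth t) (take a (enum 'I__) ++ take b (drop a (enum 'I__)))) &&
    ker (map (tnth t) (take a (enum 'I__) ++ drop b (drop a (enum 'I__))))]).
  by apply: measurable_bool_and; exact: mker.
apply/seteqP; split=> t; rewrite /shared_pairs /=;
  by rewrite !map_cat !(map_take, map_drop) !map_tnth_enum.
Qed.

Arguments measurable_shared_pairs : clear implicits.

Definition shared_measure a b : \bar R := Lam (a + (b + b))%N (shared_pairs a b).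

(** Fubini: for fixed shared points the two groups of b further points range over a product set,
    whence the square. *)
Lemma shared_measure_le a b : (a + b)%N = k ->
  (shared_measure a b <= \int[Lam a]_x
    (\int[Lam b]_y (on_points k h (x ++ y))%:R%:E) ^+ 2)%E.
Proof.
move=> abk.
pose K (x : a.-tuple T) := [set y : b.-tuple T | ker (x ++ y)].
have mK2 : measurable [set xy : a.-tuple T * b.-tuple T | ker (xy.1 ++ xy.2)].
  have := @measurable_cat_pair _ T a b measurableT [set t | ker t]
    (@measurable_kernel_tuple _ _ _ _ _ Adiag mA mh _).
  by rewrite setTI.
have mK x : measurable (K x).
  rewrite (_ : K x = xsection [set xy : a.-tuple T * b.-tuple T | ker (xy.1 ++ xy.2)] x).
    exact: measurable_xsection.
  by apply/seteqP; split=> y; rewrite /xsection /K /=; [exact: mem_set|move/set_mem].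
have sectE (x : a.-tuple T) :
    Lam (b + b)%N (xsection (@cat_pair _ T a (b + b) @^-1` shared_pairs a b) x) =
    (Lam b (K x) ^+ 2)%E.
  have mS : measurable (xsection (@cat_pair _ T a (b + b) @^-1` shared_pairs a b) x).
    apply: measurable_xsection; rewrite -[X in measurable X]setTI.
    by apply: measurable_cat_pair => //; exact: measurable_shared_pairs.
  rewrite (power_measure_cat lam mS) -[RHS]/(Lam b (K x) * Lam b (K x))%E.
  rewrite -product_measure1E//; congr ((_ \x _)%E _).
  have E (y z : b.-tuple T) : shared_pairs a b (cat_pair (x, cat_pair (y, z))) <->
      ker (x ++ y) && ker (x ++ z).
    rewrite /shared_pairs /=; rewrite !take_size_cat ?size_tuple// drop_size_cat ?size_tuple//.
    by rewrite take_size_cat ?size_tuple// drop_size_cat ?size_tuple.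
  apply/seteqP; split=> -[y z]; rewrite /xsection /=.
    by move=> /set_mem /= /E /andP.
  by move=> [yK zK]; apply/mem_set => /=; apply/E/andP.
rewrite /shared_measure (power_measure_cat lam (measurable_shared_pairs a b)).
apply: ge0_le_integral_nonmeas => x //=.
rewrite sectE.
have Kle : (Lam b (K x) <= \int[Lam b]_y (on_points k h (x ++ y))%:R%:E)%E.
  have <- : (\int[Lam b]_y (\1_(K x) y)%:E)%E = Lam b (K x).
    by rewrite integral_indic// setIT.
  apply: ge0_le_integral_nonmeas => y.
    by rewrite lee_fin.
  rewrite lee_fin ler_nat; case: (boolP (y \in K x)) => // /set_mem Kxy.
  by rewrite (kernel_seq_on_points Adiag Kxy).
by rewrite !expe2; apply: lee_pmul.
Qed.

Variable m : nat.
Hypothesis k0 : (0 < k)%N.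

Local Notation first := (ord_first k m).
Local Notation last := (ord_last k m).

(** The event involves the k + b distinct coordinates [r2] (shared), [r3] (the rest of the last
    part) and [r1]; the other m - b contribute a factor [mass] each. *)
Lemma power_measure_shared b (r1 r2 : seq 'I_(m + k)) : (b <= k)%N ->
  r1 \in subs b first -> r2 \in subs (k - b) last ->
  Lam (m + k)%N [set x : (m + k).-tuple T | ker_last x && ker (map (tnth x) (r2 ++ r1))] =
  ((mass ^+ (m - b))%:E * shared_measure (k - b) b)%E.
Proof.
move=> bk; rewrite !mem_subs => /andP[r1f /eqP r1b] /andP[r2l /eqP r2b].
have ufl : uniq (first ++ last) by rewrite (perm_uniq (perm_ord_first_last k m)) enum_uniq.
have /and3P[uf /hasPn fl ul] : [&& uniq first, ~~ has [in first] last & uniq last].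
  by rewrite -cat_uniq.
pose r3 := [seq i <- last | i \notin r2].
have p23 : perm_eq (r2 ++ r3) last.
  apply: uniq_perm => //.
    rewrite cat_uniq (subseq_uniq r2l ul) filter_uniq// andbT.
    by apply/hasPn => i; rewrite mem_filter => /andP[].
  move=> i; rewrite mem_cat mem_filter; case: (boolP (i \in r2)) => //= ir2.
  by rewrite (mem_subseq r2l).
have r3b : size r3 = b.
  have := perm_size p23; rewrite size_cat r2b size_ord_last => E.
  by apply/eqP; rewrite -(eqn_add2l (k - b)) E subnK.
pose s := r2 ++ (r3 ++ r1).
have ss : size s == (k - b + (b + b))%N by rewrite !size_cat r1b r2b r3b.
have us : uniq (Tuple ss).
  rewrite /= /s catA cat_uniq (perm_uniq p23) ul (subseq_uniq r1f uf) andbT /=.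
  apply/hasPn => i ir1; rewrite (perm_mem p23); apply/negP => il.
  by have := fl _ il; rewrite (mem_subseq r1f).
have := power_measure_sel lam us (measurable_shared_pairs (k - b) b).
rewrite (_ : (m + k - (k - b + (b + b)) = m - b)%N); last by lia.
rewrite -/mass -/(shared_measure _ _) => <-; congr (Lam _ _).
apply/seteqP; split=> x; rewrite /shared_pairs /= /ker_last /s !map_cat;
  rewrite take_size_cat ?size_map// drop_size_cat ?size_map//;
  rewrite take_size_cat ?size_map// drop_size_cat ?size_map//;
  by rewrite -!map_cat (kernel_seq_perm _ _ _ (perm_map (tnth x) p23)).
Qed.

Let shared_list : seq (seq 'I_(m + k)) :=
  flatten [seq [seq r2 ++ r1 | r1 <- subs b first, r2 <- subs (k - b) last]
          | b <- index_iota 1 k].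

Let big_shared (V : nmodType) (F : seq 'I_(m + k) -> V) :
  \sum_(r <- shared_list) F r = \sum_(1 <= b < k) \sum_(r1 <- subs b first)
    \sum_(r2 <- subs (k - b) last) F (r2 ++ r1).
Proof.
rewrite /shared_list big_flatten big_map; apply: eq_bigr => b _.
by rewrite big_allpairs_dep.
Qed.

(** The added points lift the count across level j by more than the 1 that they contribute as a
    k-subset themselves. *)
Definition gap_set j : set ((m + k).-tuple T) :=
  [set x : (m + k).-tuple T | ker_last x && ((U_first x).+1 < j <= U x)%N].

Let ker_last_U (x : (m + k).-tuple T) : ker_last x -> ((U_first x).+1 <= U x)%N.
Proof. by move=> kl; rewrite (ustat_split A h x k0) kl add1n leq_addr. Qed.

Lemma measurable_ker_last_le (g : nat -> nat -> bool) :
  measurable [set x : (m + k).-tuple T | ker_last x && g (U_first x) (U x)].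
Proof.
apply: measurable_bool_and; first exact: mker.
have := measurable_nat2 (fun a b => nat_of_bool (g a b)) (mU first) (mUx (n := m + k)%N).
move=> /(measurable_nat_preimage [set 1%N]); congr measurable.
by apply/seteqP; split=> x /=; rewrite -/(U_first x); case: (g _ _).
Qed.

Lemma gap_split j :
  Lam (m + k)%N [set x : (m + k).-tuple T | ker_last x && (j <= U x)%N] =
  (Lam (m + k)%N [set x : (m + k).-tuple T | ker_last x && (j <= (U_first x).+1)%N] +
   Lam (m + k)%N (gap_set j))%E.
Proof.
pose D (i : unit) := [set x : (m + k).-tuple T | ker_last x && (j <= U x)%N].
pose E (i : bool) := if i then
  [set x : (m + k).-tuple T | ker_last x && (j <= (U_first x).+1)%N] else gap_set j.
have mD i : measurable (D i) by exact: (measurable_ker_last_le (fun _ b => (j <= b)%N)).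
have mE i : measurable (E i).
  case: i; first exact: (measurable_ker_last_le (fun a _ => (j <= a.+1)%N)).
  exact: (measurable_ker_last_le (fun a b => (a.+1 < j <= b)%N)).
have := @sum_measure_eq _ _ _ (Lam (m + k)%N) _ _ [:: tt] [:: true; false] D E mD mE.
rewrite !big_cons !big_nil !adde0; apply => x.
rewrite !big_cons !big_nil !addn0 /D /E /gap_set !in_bset.
case: (boolP (ker_last x)) => //= /ker_last_U; lia.
Qed.

Let sum_between J a b : (\sum_(j < J) (a < j <= b) <= minn J.-1 b - a)%N.
Proof.
elim: J => [|J IHJ]; first by rewrite big_ord0.
rewrite big_ord_recr /=; apply: leq_trans (leq_add IHJ (leqnn _)) _.
case: (boolP (a < J <= b)%N); lia.
Qed.

(** A point lies in at most U - U_first - 1 of the sets [gap_set j], and by [ustat_split] this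
    number counts the overlapping k-subsets selected by the kernel. Integrating, the choices with
    equal b have equal measure. *)
Lemma gap_sum_le J :
  (\sum_(j < J) Lam (m + k)%N (gap_set j) <=
   \sum_(1 <= b < k) ('C(m, b) * 'C(k, b))%:R%:E *
     ((mass ^+ (m - b))%:E * shared_measure (k - b) b))%E.
Proof.
pose E r := [set x : (m + k).-tuple T | ker_last x && ker (map (tnth x) r)].
have mE r : measurable (E r) by apply: measurable_bool_and; exact: mker.
have mG (j : 'I_J) : measurable (gap_set j).
  exact: (measurable_ker_last_le (fun a b => (a.+1 < j <= b)%N)).
apply: (@le_trans _ _ (\sum_(r <- shared_list) Lam (m + k)%N (E r))%E).
  apply: sum_measure_le => // x.
  have [kl|kl] := boolP (ker_last x); last first.
    by rewrite big1// => j _; rewrite /gap_set in_bset (negbTE kl).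
  apply: (@leq_trans (U x - (U_first x).+1)).
    rewrite (eq_bigr (fun j : 'I_J => ((U_first x).+1 < j <= U x)%N : nat)).
      by apply: leq_trans (sum_between _ _ _) _; lia.
    by move=> j _; rewrite /gap_set in_bset kl.
  rewrite (big_shared (fun r => x \in E r : nat)) (ustat_split A h x k0) kl.
  rewrite add1n addKn; apply/eq_leq; apply: eq_bigr => b _; apply: eq_bigr => r1 _.
  by apply: eq_bigr => r2 _; rewrite /E in_bset kl.
rewrite (big_shared (fun r => Lam (m + k)%N (E r))) big_nat [leRHS]big_nat.
apply: lee_sum => b /andP[b0 bk].
have sh0 : (0 <= (mass ^+ (m - b))%:E * shared_measure (k - b) b)%E.
  by rewrite mule_ge0 ?lee_fin ?exprn_ge0 ?fine_ge0 ?measure_ge0.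
rewrite (eq_big_seq (fun=> ('C(k, b))%:R%:E *
    ((mass ^+ (m - b))%:E * shared_measure (k - b) b))%E).
  rewrite sume_const; last by rewrite mule_ge0.
  by rewrite size_subs size_ord_first natrM EFinM muleA.
move=> r1 r1f; rewrite (eq_big_seq (fun=> (mass ^+ (m - b))%:E * shared_measure (k - b) b)%E).
  by rewrite sume_const// size_subs size_ord_last bin_sub// ltnW.
by move=> r2 r2l; exact: (power_measure_shared (ltnW bk) r1f r2l).
Qed.

End GapBound.

(** * The Poisson process *)

Section PoissonMixture.
Context d (T : measurableType d) (R : realType) (mu : probability T R).
Variables (s : R) (s_gt0 : 0 < s).
Context dO (Omega : measurableType dO) (P : probability Omega R).
Let lam : {finite_measure set T -> \bar R} := mscale (NngNum (ltW s_gt0)) mu.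
Local Notation Lam := (power_measure lam).

(* The factor s ^ n of the Poisson weights is part of power_measure. *)
Definition poisson_wt (n : nat) : R := expR (- s) / n`!%:R.

Lemma poisson_wt_ge0 n : 0 <= poisson_wt n.
Proof. by rewrite divr_ge0// expR_ge0. Qed.

Section JointLaw.
Variables (X : nat -> {mfun Omega >-> T}) (N : {mfun Omega >-> nat}).
Hypothesis Xmu : forall i B, measurable B -> P (X i @^-1` B) = mu B.
Hypothesis Npoisson : poisson_rv P N s.
Hypothesis XN : mutually_independent P (fun o : option nat =>
  if o is Some i then g_sigma_algebra_preimage (X i)
  else g_sigma_algebra_preimage N).

Definition points n (w : Omega) : n.-tuple T := [tuple X i w | i < n].

Lemma measurable_points n : measurable_fun setT (@points n).
Proof.
apply/measurable_fun_tnthP => i; rewrite (_ : _ \o _ = X i).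
  exact: measurable_funPT.
by apply/funext => w /=; rewrite tnth_mktuple.
Qed.

Lemma measurable_N n : measurable (N @^-1` [set n]).
Proof.
by rewrite -[X in measurable X]setTI; apply: (measurable_funPT N).
Qed.

Lemma P_N n : P (N @^-1` [set n]) = (poisson_wt n * s ^+ n)%:E.
Proof.
have [_ ->] := Npoisson; rewrite /poisson_prob s_gt0 esum_set1; last first.
  by rewrite lee_fin poisson_pmf_ge0.
by rewrite /poisson_pmf s_gt0 /poisson_wt; congr (_%:E); ring.
Qed.

(** Both sides are measures in B, so boxes suffice, and on boxes this is the independence of N and
    the first n points. In [J], [None] stands for N. *)
Lemma points_law n B : measurable B ->
  P (N @^-1` [set n] `&` @points n @^-1` B) = ((poisson_wt n)%:E * Lam n B)%E.
Proof.
move=> mB; have mN := measurable_N n.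
pose m1 := push_measure (mrestr P mN) (@measurable_points n).
pose m2 : {measure set (n.-tuple T) -> \bar R} :=
  mscale (NngNum (poisson_wt_ge0 n)) (Lam n).
rewrite setIC -[LHS]/(m1 B) -[RHS]/(m2 B).
apply: measure_tuple_unique => //.
  rewrite /m1 /= /pushforward /mrestr preimage_setT setTI.
  by apply: le_lt_trans (probability_le1 P mN) _; rewrite ltry.
move=> C mC; rewrite /m1 /m2 /= /mscale /= /pushforward /mrestr.
rewrite [X in _ = (_ * X)%E](power_measure_boxE lam mC).
pose C' (i : nat) : set T := if insub i is Some j then C j else setT.
have C'E (i : 'I_n) : C' i = C i by rewrite /C' valK.
pose J : {fset option nat} := [fset o in None :: map Some (iota 0 n)]%fset.
pose D (o : option nat) : set Omega :=
  if o is Some i then X i @^-1` C' i else N @^-1` [set n].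
have mC' i : measurable (C' i) by rewrite /C'; case: insubP.
have uJ : uniq (None :: map Some (iota 0 n)).
  by rewrite /= map_inj_uniq ?iota_uniq ?andbT; [apply/mapP => -[]|move=> ? ? []].
have := XN (J := J) (A := D).
have -> : \bigcap_(i in [set` J]) D i = @points n @^-1` tuple_box C `&` N @^-1` [set n].
  apply/seteqP; split=> w.
    move=> wD; split; last by apply: (wD None); rewrite /= !inE.
    move=> i; rewrite tnth_mktuple -C'E; apply: (wD (Some (val i))).
    by rewrite /= !inE /=; apply/mapP; exists (val i) => //; rewrite mem_iota ltn_ord.
  move=> [wC wN] [i|//]; rewrite /= !inE /= => /mapP[j]; rewrite mem_iota => /andP[_ jn] [->].
  rewrite add0n in jn; have := wC (Ordinal jn); rewrite tnth_mktuple.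
  by rewrite -(C'E (Ordinal jn)).
move=> ->; last first.
  move=> [i|] _ /=; [exists (C' i) => //|exists [set n] => //]; by rewrite setTI.
rewrite (perm_big _ (perm_fset_seq uJ)) big_cons big_map /=.
have -> : iota 0 n = index_iota 0 n by rewrite /index_iota subn0.
rewrite big_mkord P_N.
have -> : \prod_(i < n) fine (P (X i @^-1` C' i)) = \prod_(i < n) fine (mu (C i)).
  by apply: eq_bigr => i _; rewrite Xmu// C'E.
rewrite -EFinM /=; congr (_%:E); rewrite -mulrA; congr (_ * _).
have <- : \prod_(i < n) s = s ^+ n by rewrite prodr_const card_ord.
rewrite -big_split /=; apply: eq_bigr => i _; rewrite /lam /= /mscale /= fineM ?fin_num_measure//.
Qed.

End JointLaw.
End PoissonMixture.

(** * The law of the statistic as a Poisson mixture *)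

Section LawOfStatistic.
Context d (T : measurableType d) (R : realType) (mu : probability T R).
Variables (s : R) (s_gt0 : 0 < s).
Context dO (Omega : measurableType dO) (P : probability Omega R).
Let lam : {finite_measure set T -> \bar R} := mscale (NngNum (ltW s_gt0)) mu.
Local Notation Lam := (power_measure lam).
Variables (A : set (T * T)) (k : nat) (h : config T -> bool).
Hypotheses (Adiag : forall x, A (x, x)) (mA : measurable A).
Hypothesis A0 : (mu \x mu)%E A = 0%E.
Hypothesis mh : measurable_fun (config_card k) h.
Variable eta : Omega -> config T.
Hypothesis eta_poisson : poisson_process P s mu eta.
Local Notation ker := (kernel_seq A k h).
Local Notation U := (ustat A k h).
Let F := subset_count k h \o eta.
Let wt := poisson_wt s.

Lemma mass_scale : fine (lam setT) = s.
Proof. by rewrite /lam /= /mscale /= probability_setT mule1. Qed.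

Lemma measurable_statistic : measurable_fun setT F.
Proof.
have [meta _] := eta_poisson.
by apply: measurableT_comp => //; exact: measurable_subset_count mh.
Qed.

Let mUn n : measurable_fun setT (fun x : n.-tuple T => U x) :=
  measurable_ustat Adiag mA mh (n := n).

Lemma measure_ae_le (B C : set Omega) : measurable B -> measurable C ->
  {ae P, forall w, B w -> C w} -> (P B <= P C)%E.
Proof.
move=> mB mC [E [mE PE BC]].
apply: (@le_trans _ _ (P (C `|` E))).
  apply: le_measure; rewrite ?inE//; first exact: measurableU.
  move=> w Bw; have [Cw|nCw] := pselect (C w); first by left.
  by right; apply: BC => /= /(_ Bw).
apply: (@le_trans _ _ (P C + P E)%E); first exact: measureU2.
by rewrite [X in (_ + X)%E]PE adde0.
Qed.

(** Almost surely, on N = n the configuration is the set of the first n points and these avoid [A]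
    pairwise, so the statistic equals [U] of the tuple. *)
Lemma statistic_law S :
  P (F @^-1` S) = (\sum_(n <oo) (wt n)%:E * Lam n [set x | S (U x)])%E.
Proof.
have [meta [X [N [Xmu NP XN etaE]]]] := eta_poisson.
have mF := measurable_nat_preimage S measurable_statistic.
have lamA : (lam \x lam)%E A = 0%E.
  have mlam : measurable_fun setT (lam \o xsection A) by exact: measurable_fun_xsection.
  have mmu : measurable_fun setT (mu \o xsection A) by exact: measurable_fun_xsection.
  rewrite /product_measure1 (ge0_integral_mscale _ _ _ mlam)//.
  rewrite [X in (_ * X)%E](_ : _ = 0%E) ?mule0//.
  rewrite (_ : lam \o xsection A = (fun x => s%:E * (mu \o xsection A) x)%E)//.
  rewrite ge0_integralZl//; last by rewrite lee_fin ltW.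
  by rewrite -/((mu \x mu)%E A) A0 mule0.
have mUS n : measurable [set x : n.-tuple T | S (U x)].
  exact: (measurable_nat_preimage S (@mUn n)).
have mNn n := measurable_N N n.
have mpt n B : measurable B -> measurable (@points _ _ _ _ X n @^-1` B).
  by move=> mB; rewrite -[X in measurable X]setTI; exact: measurable_points.
have off n : {ae P, forall w, N w = n -> pairwise (off_diag A) (points X n w)}.
  exists (N @^-1` [set n] `&` points X n @^-1` [set x | ~~ pairwise (off_diag A) x]).
  have mo : measurable [set x : n.-tuple T | ~~ pairwise (off_diag A) x].
    rewrite (_ : mkset _ = ~` [set x : n.-tuple T | pairwise (off_diag A) x]).
      by apply: measurableC; exact: measurable_off_diag.
    by apply/seteqP; split=> x /= /negP.
  split; first by apply: measurableI => //; exact: mpt.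
    by rewrite (points_law s_gt0 Xmu NP XN mo) (power_measure_off_diag mA)// mule0.
  by move=> w /= /not_implyP[Nw /negP].
have FE n : {ae P, forall w, N w = n -> F w = U (points X n w)}.
  move: etaE (off n); apply: filterS2 => w etaw offw Nw.
  rewrite -(subset_count_off_diag _ _ Adiag (offw Nw)) /F /= etaw Nw.
  congr (subset_count k h _); apply/fsetP => x; rewrite !inE.
  apply/imfsetP/mapP => [[i /=]|[i _ ->]].
    rewrite mem_iota => /andP[_ iN] ->.
    by exists (Ordinal iN) => //; rewrite mem_enum.
  by exists (val i) => //=; rewrite mem_iota ltn_ord.
transitivity (\sum_(n <oo) P (F @^-1` S `&` N @^-1` [set n]))%E.
  have mI n : measurable (F @^-1` S `&` N @^-1` [set n]) by exact: measurableI.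
  transitivity (P (\bigcup_n (F @^-1` S `&` N @^-1` [set n]))).
    by congr (P _); apply/seteqP; split=> w; [move=> Sw; exists (N w)|move=> [n _ []]].
  apply/esym/cvg_lim => //; apply: measure_semi_sigma_additive => //.
  - apply/trivIsetP => i j _ _ /eqP ij; apply/seteqP; split=> // w [[_ /= wi] [_ /= wj]].
    by apply: ij; rewrite -wi -wj.
  - exact: bigcup_measurable.
apply: eq_eseriesr => n _.
rewrite -(points_law s_gt0 Xmu NP XN (mUS n)); apply/eqP; rewrite eq_le.
have m1 : measurable (F @^-1` S `&` N @^-1` [set n]) by exact: measurableI.
have m2 : measurable (N @^-1` [set n] `&` points X n @^-1` [set x | S (U x)]).
  by apply: measurableI => //; exact: mpt.
apply/andP; split; apply: measure_ae_le => //; move: (FE n); apply: filterS => w Fw.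
  by move=> [Sw Nw]; split=> //=; rewrite -Fw.
by move=> [Nw Sw]; split=> //=; rewrite -/(F w) Fw.
Qed.

Lemma statistic_integral (phi : nat -> \bar R) : (forall i, 0 <= phi i)%E ->
  (\int[P]_w phi (F w) = \sum_(n <oo) (wt n)%:E * \int[Lam n]_x phi (U x))%E.
Proof.
move=> phi0; have mphi D : measurable_fun D phi by [].
pose m_ n : {measure set nat -> \bar R} :=
  mscale (NngNum (poisson_wt_ge0 s n)) (push_measure (Lam n) (@mUn n)).
transitivity (\int[push_measure P measurable_statistic]_i phi i)%E.
  by rewrite ge0_integral_pushforward//; exact: measurable_statistic.
transitivity (\int[mseries m_ 0]_i phi i)%E.
  apply: eq_measure_integral => S _ _.
  by rewrite /= /pushforward statistic_law /mseries /= /mscale.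
rewrite ge0_integral_measure_series//; apply: eq_eseriesr => n _.
by rewrite ge0_integral_mscale//= ge0_integral_pushforward//; exact: mUn.
Qed.

End LawOfStatistic.

(** * Mecke formula and the gaps *)

Section GapIdentity.
Context d (T : measurableType d) (R : realType) (mu : probability T R).
Variables (s : R) (s_gt0 : 0 < s).
Context dO (Omega : measurableType dO) (P : probability Omega R).
Let lam : {finite_measure set T -> \bar R} := mscale (NngNum (ltW s_gt0)) mu.
Local Notation Lam := (power_measure lam).
Variables (A : set (T * T)) (k : nat) (h : config T -> bool).
Hypotheses (Adiag : forall x, A (x, x)) (mA : measurable A).
Hypothesis A0 : (mu \x mu)%E A = 0%E.
Hypothesis mh : measurable_fun (config_card k) h.
Variable eta : Omega -> config T.
Hypothesis eta_poisson : poisson_process P s mu eta.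
Hypothesis k0 : (0 < k)%N.
Local Notation ker := (kernel_seq A k h).
Local Notation U := (ustat A k h).
Local Notation gap_set := (gap_set A h).
Let F := subset_count k h \o eta.
Let wt := poisson_wt s.

Let integralF := statistic_integral s_gt0 Adiag mA A0 mh eta_poisson.

Let wt0 n : (0 <= (wt n)%:E)%E.
Proof. by rewrite lee_fin poisson_wt_ge0. Qed.

Lemma nneseries_shift (f : nat -> \bar R) b : (forall m, 0 <= f m)%E ->
  (forall m, (m < b)%N -> f m = 0%E) ->
  (\sum_(m <oo) f m = \sum_(m <oo) f (m + b)%N)%E.
Proof.
move=> f0 fb; rewrite nneseries_addn// (@nneseries_split _ _ 0%N b)// add0n.
by rewrite big_nat big1 ?add0e// => m /andP[_ /fb].
Qed.

Lemma poisson_wt_shift m b :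
  wt (m + b)%N * 'C(m + b, b)%:R = b`!%:R^-1 * wt m.
Proof.
have := bin_fact (leq_addl m b); rewrite addnK => /(congr1 (fun n => n%:R : R)).
rewrite !natrM /wt /poisson_wt => <-.
have fn0 n : n`!%:R != 0 :> R by rewrite pnatr_eq0 -lt0n fact_gt0.
have c0 : 'C(m + b, b)%:R != 0 :> R by rewrite pnatr_eq0 -lt0n bin_gt0 leq_addl.
by field; rewrite c0 !fn0.
Qed.

(** No exponential series is summed: this is the mixture formula for the constant 1, as P has total
    mass 1. *)
Lemma poisson_wt_sum1 : (\sum_(n <oo) (wt n)%:E * (s ^+ n)%:E = 1)%E.
Proof.
have := integralF (phi := fun=> 1%E) (fun=> lee01).
rewrite integral_cst// mul1e => E; rewrite -[RHS](probability_setT P) [RHS]E.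
apply: eq_eseriesr => n _; rewrite integral_cst// mul1e.
by rewrite [X in _ = (_ * X)%E](power_measure_setT lam n) mass_scale.
Qed.

Lemma poisson_factorial_sum b :
  (\sum_(m <oo) (wt m)%:E * ('C(m, b)%:R * s ^+ (m - b))%:E = (b`!%:R^-1)%:E)%E.
Proof.
rewrite (@nneseries_shift _ b); last 2 first.
- by move=> m; rewrite mule_ge0// lee_fin mulr_ge0// exprn_ge0// ltW.
- by move=> m mb; rewrite bin_small// mul0r mule0.
rewrite -[RHS]mule1 -poisson_wt_sum1 -nneseriesZl; last first.
  by move=> n _; rewrite mule_ge0// lee_fin exprn_ge0// ltW.
apply: eq_eseriesr => m _.
by rewrite addnK -EFinM mulrA poisson_wt_shift -mulrA !EFinM.
Qed.

Let mUn n : measurable_fun setT (fun x : n.-tuple T => U x) :=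
  measurable_ustat Adiag mA mh (n := n).

(** Expand one factor [U] over index lists; by exchangeability each of the C(m + k, k) lists
    contributes like the last k indices, and the binomial turns the weight of m + k into that of m
    divided by k!. *)
Lemma statistic_ge_mean j :
  (\int[P]_w ((j <= F w)%N%:R * (F w)%:R)%:E =
   (k`!%:R^-1)%:E * \sum_(m <oo) (wt m)%:E *
     Lam (m + k)%N [set x : (m + k).-tuple T | ker_last A h x && (j <= U x)%N])%E.
Proof.
rewrite (integralF (phi := fun i => ((j <= i)%N%:R * i%:R)%:E)); last first.
  by move=> i; rewrite lee_fin mulr_ge0.
pose E n (r : seq 'I_n) := [set x : n.-tuple T | ker (map (tnth x) r) && (j <= U x)%N].
have mE n (r : seq 'I_n) : measurable (E n r).
  apply: measurable_bool_and; first exact: measurable_kernel_sel.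
  exact: (measurable_nat_preimage [set i | (j <= i)%N] (@mUn n)).
have intU n : (\int[Lam n]_x ((j <= U x)%N%:R * (U x)%:R)%:E =
    \sum_(r <- subs k (enum 'I_n)) Lam n (E n r))%E.
  rewrite (eq_bigr (fun r => \int[Lam n]_x (\1_(E n r) x)%:E)%E); last first.
    by move=> r _; rewrite integral_indic; [rewrite setIT| |exact: mE].
  rewrite -ge0_integral_sum//; last first.
    move=> r; apply/measurable_EFinP; apply: measurable_indic.
    exact: mE.

  apply: eq_integral => x _; rewrite sumEFin; congr (_%:E).
  rewrite {2}/ustat -{2}(map_tnth_enum x) map_subs big_map natr_sum mulr_sumr.
  apply: eq_bigr => r _; rewrite indicE.
  have -> : (x \in E n r) = ker (map (tnth x) r) && (j <= U x)%N.
    by apply/idP/idP => [/set_mem|/mem_set].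
  by case: (_ <= _)%N; case: (ker _); rewrite ?mul1r ?mul0r.
rewrite (@nneseries_shift _ k); last 2 first.
- by move=> m; rewrite mule_ge0// integral_ge0// => x _; rewrite lee_fin mulr_ge0.
- by move=> m mk; rewrite intU subs_geq_nil ?size_enum_ord// big_nil mule0.
rewrite -nneseriesZl; last by move=> m _; rewrite mule_ge0.
apply: eq_eseriesr => m _; rewrite intU.
rewrite (eq_big_seq (fun=> Lam (m + k)%N (E _ (ord_last k m)))); last first.
  move=> r; rewrite mem_subs => /andP[re /eqP rk].
  apply: (power_measure_exch Adiag mA mh) => //.
  - exact: subseq_uniq re (enum_uniq _).
  - by rewrite map_inj_uniq ?enum_uniq//; exact: rshift_inj.
  - exact: size_ord_last.
rewrite sume_const// size_subs size_enum_ord muleA -EFinM poisson_wt_shift.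
by rewrite EFinM -muleA.
Qed.

Definition kernel_mass : R := fine (Lam k [set x | ker x]).

Lemma kernel_massE : Lam k [set x | ker x] = kernel_mass%:E.
Proof.
by rewrite fineK// power_measure_fin//; exact: measurable_kernel_tuple.
Qed.

(** The gap in its Mecke form, from which nonnegativity is evident. *)
Definition gap_mass j : \bar R :=
  ((k`!%:R^-1)%:E * \sum_(m <oo) (wt m)%:E * Lam (m + k)%N (gap_set j))%E.

Lemma gap_mass_ge0 j : (0 <= gap_mass j)%E.
Proof. by rewrite mule_ge0 ?lee_fin ?invr_ge0// nneseries_ge0// => *; rewrite mule_ge0. Qed.

Lemma statistic_gap j :
  (\int[P]_w ((j <= F w)%N%:R * (F w)%:R)%:E =
   (k`!%:R^-1 * kernel_mass)%:E * \int[P]_w ((j <= (F w).+1)%N%:R)%:E + gap_mass j)%E.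
Proof.
rewrite statistic_ge_mean (integralF (phi := fun i => ((j <= i.+1)%N%:R)%:E)); last first.
  by move=> i; rewrite lee_fin.
rewrite EFinM -muleA -[(kernel_mass%:E * _)%E]nneseriesZl; last first.
  by move=> m _; rewrite mule_ge0// integral_ge0// => x _; rewrite lee_fin.
rewrite /gap_mass -ge0_muleDr; last 2 first.
- apply: nneseries_ge0 => m _ _; rewrite mule_ge0 ?lee_fin ?fine_ge0//.
  by rewrite mule_ge0// integral_ge0// => x _; rewrite lee_fin.
- by apply: nneseries_ge0 => m _ _; rewrite mule_ge0.
rewrite -nneseriesD; last 2 first.
- move=> m _ _; rewrite mule_ge0 ?lee_fin ?fine_ge0//.
  by rewrite mule_ge0// integral_ge0// => x _; rewrite lee_fin.
- by move=> m _ _; rewrite mule_ge0.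
congr (_ * _)%E; apply: eq_eseriesr => m _.
rewrite (gap_split Adiag mA mh lam m k0 j) (power_measure_first_last Adiag mA mh).
rewrite kernel_massE ge0_muleDr//; last by rewrite mule_ge0// lee_fin fine_ge0.
congr (_ + _)%E; rewrite muleA muleC; congr (_ * (_ * _))%E.
pose E := [set y : m.-tuple T | (j <= (U y).+1)%N].
have mE : measurable E by exact: (measurable_nat_preimage [set i | (j <= i.+1)%N] (@mUn m)).
have := integral_indic (Lam m) measurableT mE; rewrite setIT => <-.
apply: eq_integral => x _; congr (_%:E); rewrite indicE; congr (_%:R).
by congr nat_of_bool; apply/idP/idP => [/set_mem|/mem_set].
Qed.

(** The case j = 0 of [statistic_gap]: both indicators are 1 and the gap set is empty. *)
Lemma statistic_mean : (\int[P]_w ((F w)%:R)%:E = (k`!%:R^-1 * kernel_mass)%:E)%E.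
Proof.
have := statistic_gap 0; rewrite /gap_mass.
under eq_integral do rewrite mul1r.
under [X in (_ * X + _)%E]eq_integral do rewrite /=.
rewrite integral_cst// mul1e [X in (_ * X)%E](probability_setT P) mule1 => ->.
rewrite eseries0 ?mule0 ?adde0// => m _ _.
rewrite (_ : gap_set 0 = set0) ?measure0 ?mule0//.
by apply/seteqP; split=> // x; rewrite /gap_set /= => /andP[].
Qed.

Lemma gap_mass_sum J :
  (\sum_(j < J) gap_mass j <= gamma k h lam * (k`!%:R^-1)%:E)%E.
Proof.
pose c a b := shared_measure A k h lam a b.
have c0 a b : (0 <= c a b)%E by exact: measure_ge0.
have cfin a b : c a b = (fine (c a b))%:E.
  by rewrite fineK// power_measure_fin//; exact: measurable_shared_pairs.
rewrite /gap_mass -ge0_sume_distrr; last first.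
  by move=> j _; apply: nneseries_ge0 => m _ _; rewrite mule_ge0.
rewrite muleC; apply: lee_wpmul2r; first by rewrite lee_fin invr_ge0.
rewrite -nneseries_sum; last by move=> j m _; rewrite mule_ge0.
pose G b m := (('C(k, b)%:R%:E * c (k - b)%N b) *
   ((wt m)%:E * ('C(m, b)%:R * s ^+ (m - b))%:E))%E.
have w0 b m : (0 <= (wt m)%:E * ('C(m, b)%:R * s ^+ (m - b))%:E)%E.
  by rewrite mule_ge0// lee_fin mulr_ge0// exprn_ge0// ltW.
have G0 b m : (0 <= G b m)%E by rewrite mule_ge0// mule_ge0// lee_fin.
apply: (@le_trans _ _ (\sum_(m <oo) \sum_(1 <= b < k) G b m)%E).
  apply: lee_nneseries => m _.
    by move=> _; apply: sume_ge0 => j _; rewrite mule_ge0.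
  rewrite -ge0_sume_distrr//.
  have := gap_sum_le Adiag mA mh lam m k0 J; rewrite mass_scale.
  move=> /(lee_wpmul2l (wt0 m))/le_trans; apply.
  rewrite ge0_sume_distrr; last first.
    by move=> b _; rewrite mule_ge0 ?lee_fin// mule_ge0// lee_fin exprn_ge0// ltW.
  apply: lee_sum => b _; rewrite /G -/(c _ _) cfin -!EFinM lee_fin natrM.
  by rewrite le_eqVlt; apply/orP; left; apply/eqP; ring.
rewrite nneseries_sum; last by move=> b m _; exact: G0.
(* [gamma] is indexed by the number l of shared points, here k - b, hence the reversal. *)
rewrite /gamma [leLHS]big_nat_rev /= big_nat [leRHS]big_nat.
apply: lee_sum => l /andP[l0 lk].
rewrite /G; have -> : (1 + k - l.+1 = k - l)%N by lia.
have -> : (k - (k - l) = l)%N by lia.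
rewrite cfin -EFinM nneseriesZl//.
rewrite poisson_factorial_sum -EFinM mulrAC EFinM -cfin.
have fn0 n : n`!%:R != 0 :> R by rewrite pnatr_eq0 -lt0n fact_gt0.
(* The choice of the shared points and the factorial sum over m together produce the coefficient in
   [gamma]. *)
have -> : 'C(k, k - l)%:R / (k - l)`!%:R = k`!%:R / (l`!%:R * (k - l)`!%:R ^+ 2) :> R.
  rewrite bin_sub ?(ltnW lk)//.
  have := bin_fact (ltnW lk) => /(congr1 (fun n => n%:R : R)); rewrite !natrM => <-.
  by field; rewrite !fn0.
apply: lee_wpmul2l; first by rewrite lee_fin divr_ge0// mulr_ge0// exprn_ge0.
by apply: shared_measure_le => //; rewrite subnKC// ltnW.
Qed.

End GapIdentity.

(** * Expectations as mean functionals *)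

Section MeanOfLaw.
Context d (Om : measurableType d) (R : realType) (P : probability Om R).
Variables (X : Om -> nat) (al : R).
Hypothesis mX : measurable_fun setT X.
Hypothesis EX : (\int[P]_w ((X w)%:R)%:E = al%:E)%E.

Definition law_mean (phi : nat -> R) : R := (\int[P]_w phi (X w))%R.

Let mphi (phi : nat -> R) : measurable_fun setT (fun w => phi (X w)).
Proof. by apply: (measurableT_comp (f := phi)). Qed.

Let int_X : P.-integrable setT (fun w => ((X w)%:R)%:E).
Proof.
apply/integrableP; split; first by apply/measurable_EFinP; exact: (mphi (fun i => i%:R)).
under eq_integral do rewrite gee0_abs ?lee_fin//.
by rewrite EX ltry.
Qed.

Lemma integrable_lin_growth phi : lin_growth phi ->
  P.-integrable setT (fun w => (phi (X w))%:E).
Proof.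
move=> [C phiC].
have int1 : P.-integrable setT (fun w => (C * (1 + (X w)%:R))%:E).
  under eq_fun do rewrite EFinM EFinD.
  apply: integrableZl => //; apply: integrableD => //.
  exact: finite_measure_integrable_cst.
apply: le_integrable int1 => //.
  by apply/measurable_EFinP; exact: mphi.
move=> w _; rewrite !abse_EFin lee_fin; apply: le_trans (phiC _) _.
exact: ler_norm.
Qed.

Let ilg := integrable_lin_growth.

Lemma law_meanE phi : lin_growth phi ->
  (\int[P]_w (phi (X w))%:E = (law_mean phi)%:E)%E.
Proof. by move=> /ilg int; rewrite /law_mean /Rintegral fineK//; exact: integrable_fin_num. Qed.

Lemma law_mean_functional : mean_functional al law_mean.
Proof.
split.
- by move=> phi psi lp lq; exact: RintegralD (ilg lp) (ilg lq).
- by move=> a phi lp; exact: RintegralZl (ilg lp).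
- by move=> phi psi lp lq pq; apply: le_Rintegral => //; [exact: ilg|exact: ilg].
- by rewrite /law_mean Rintegral_cst// [X in fine X](probability_setT P) mulr1.
- by rewrite /law_mean /Rintegral EX.
move=> e e0.
pose g w := (1 * (1 + (X w)%:R) : R)%:E.
pose f_ n w := (tail_weight R n (X w))%:E.
(* The first-moment tails tend to 0 by dominated convergence, with 1 + X as dominating function. *)
have [|||||_ _] := @dominated_convergence _ _ _ P setT measurableT f_ (cst 0%E) g.
- by move=> n; apply/measurable_EFinP; exact: mphi.
- by [].
- apply: aeW => w _; apply: cvg_near_cst; near=> n; rewrite /f_ /tail_weight.
  rewrite ltnNge (_ : (X w <= n)%N) ?mul0r//.
  by near: n; exists (X w).
- apply: (@ilg (fun i => 1 * (1 + i%:R))); exists 1 => i.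
  by rewrite mul1r ger0_norm// addr_ge0.
- apply: aeW => w n _; rewrite /f_ /g abse_EFin lee_fin.
  rewrite ger0_norm ?mulr_ge0 ?addr_ge0//; apply: ler_pM => //; rewrite ?addr_ge0//.
  by case: (_ < _)%N.
rewrite integral_cst// mul0e => /fine_cvgP[_].
move/cvgrPdist_le => /(_ e e0)[m _ mP]; exists m => M mM.
have := mP M mM; rewrite /= sub0r normrN; apply: le_trans.
exact: ler_norm.
Unshelve. all: by end_near. Qed.

End MeanOfLaw.

(** * Mean and vanishing gaps of the Poisson law *)

Section PoissonLaw.
Context d (Om : measurableType d) (R : realType) (Q : probability Om R).
Variables (Z : Om -> nat) (al : R).
Hypothesis ZP : poisson_rv Q Z al.

Lemma poisson_rv_mean0 : al = 0 -> (\int[Q]_w ((Z w)%:R)%:E = 0)%E.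
Proof.
move=> al0; have [mZ ZQ] := ZP.
transitivity (\int[push_measure Q mZ]_i (i%:R : R)%:E)%E.
  by rewrite ge0_integral_pushforward// => i _; rewrite lee_fin.
transitivity (\int[\d_0%N]_i (i%:R : R)%:E)%E.
  apply: eq_measure_integral => S _ _; rewrite /= /pushforward ZQ.
  by rewrite /poisson_prob al0 ltxx.
by rewrite integral_dirac// mule0.
Qed.

Hypothesis al0 : 0 < al.
Let wt := poisson_wt al.

Lemma poisson_rv_integral (phi : nat -> \bar R) : (forall i, 0 <= phi i)%E ->
  (\int[Q]_w phi (Z w) = \sum_(n <oo) (wt n * al ^+ n)%:E * phi n)%E.
Proof.
move=> phi0; have [mZ ZQ] := ZP.
have wt0 n : 0 <= wt n * al ^+ n.
  by rewrite mulr_ge0 ?poisson_wt_ge0// exprn_ge0// ltW.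
pose m_ n : {measure set nat -> \bar R} := mscale (NngNum (wt0 n)) \d_n.
transitivity (\int[push_measure Q mZ]_i phi i)%E.
  by rewrite ge0_integral_pushforward.
transitivity (\int[mseries m_ 0]_i phi i)%E.
  apply: eq_measure_integral => S _ _; rewrite /= /pushforward ZQ.
  rewrite /poisson_prob al0 /mseries /=.
  rewrite -[in LHS](set_mem_set S) -nneseries_esum; last first.
    by move=> n _; rewrite lee_fin poisson_pmf_ge0.
  rewrite eseries_mkcond; apply: eq_eseriesr => n _.
  rewrite /m_ /= /mscale /= diracE; case: ifPn => nS; last by rewrite mule0.
  rewrite mule1 /poisson_pmf al0 /wt /poisson_wt; congr (_%:E); ring.
rewrite ge0_integral_measure_series//; apply: eq_eseriesr => n _.
by rewrite ge0_integral_mscale//= integral_dirac// diracT mul1e.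
Qed.

(** Shifting the series by one absorbs the factor n into the Poisson weight; the term n = 0
    vanishes. *)
Lemma poisson_rv_gap j :
  (\int[Q]_w ((j <= Z w)%N%:R * (Z w)%:R)%:E =
   al%:E * \int[Q]_w ((j <= (Z w).+1)%N%:R)%:E)%E.
Proof.
rewrite (poisson_rv_integral (phi := fun i => ((j <= i)%N%:R * i%:R)%:E)); last first.
  by move=> i; rewrite lee_fin mulr_ge0.
rewrite (poisson_rv_integral (phi := fun i => ((j <= i.+1)%N%:R)%:E)); last first.
  by move=> i; rewrite lee_fin.
have wt0 n : 0 <= wt n * al ^+ n.
  by rewrite mulr_ge0 ?poisson_wt_ge0// exprn_ge0// ltW.
rewrite (@nneseries_shift _ _ 1%N); last 2 first.
- by move=> m; rewrite mule_ge0 ?lee_fin// mulr_ge0.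
- by move=> [|//] _; rewrite mulr0 mule0.
rewrite -nneseriesZl; last by move=> n _; rewrite mule_ge0 ?lee_fin.
apply: eq_eseriesr => m _; rewrite -!EFinM; congr (_%:E).
have := poisson_wt_shift al m 1; rewrite bin1 (_ : 1`! = 1)%N// invr1 mul1r -/wt => <-.
by rewrite addn1 exprS; ring.
Qed.

Lemma poisson_rv_mean : (\int[Q]_w ((Z w)%:R)%:E = al%:E)%E.
Proof.
have := poisson_rv_gap 0; under eq_integral do rewrite mul1r.
move=> ->; rewrite (eq_integral (cst 1%E))//.
by rewrite integral_cst// mul1e [X in (_ * X)%E](probability_setT Q) mule1.
Qed.

End PoissonLaw.

(** * From mean functionals to the two distances *)

Section Distances.
Variable R : realType.

(** All integrals involved are finite by linear growth, so [G] cannot be infinite and is obtained by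
    subtraction in R. *)
Lemma mean_gapE d (Om : measurableType d) (P : probability Om R)
    (X : Om -> nat) (al : R) j (G : \bar R) (mX : measurable_fun setT X)
    (EX : (\int[P]_w ((X w)%:R)%:E = al%:E)%E) : (0 <= G)%E ->
  (\int[P]_w ((j <= X w)%N%:R * (X w)%:R)%:E =
   al%:E * \int[P]_w ((j <= (X w).+1)%N%:R)%:E + G)%E ->
  G = (mean_gap al (law_mean P X) j)%:E.
Proof.
move=> G0.
rewrite (law_meanE mX EX (phi := fun i => (j <= i)%N%:R * i%:R)); last first.
  exact: (@lin_growth_nat R (fun i => (j <= i)%N)).
rewrite (law_meanE mX EX (phi := fun i => (j <= i.+1)%N%:R)); last first.
  exact: (@lin_growth_ind R (fun i => (j <= i.+1)%N)).
rewrite /mean_gap; case: G G0 => [r _|_|//].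
  by rewrite -EFinM -EFinD => -[->]; congr (_%:E); ring.
by rewrite -EFinM addey.
Qed.

Variables (d1 : measure_display) (O1 : measurableType d1) (P : probability O1 R).
Variables (d2 : measure_display) (O2 : measurableType d2) (Q : probability O2 R).
Variables (X : O1 -> nat) (Z : O2 -> nat) (al : R) (B : \bar R).
Hypotheses (mX : measurable_fun setT X) (al_ge0 : 0 <= al).
Hypothesis EX : (\int[P]_w ((X w)%:R)%:E = al%:E)%E.
Hypothesis ZP : poisson_rv Q Z al.
Hypothesis B0 : (0 <= B)%E.
Hypothesis gap_ge0 : forall j, 0 <= mean_gap al (law_mean P X) j.
Hypothesis gap_le : forall J,
  (\sum_(j < J) (mean_gap al (law_mean P X) j)%:E <= B)%E.

Let mZ : measurable_fun setT Z. Proof. by case: ZP. Qed.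

Let EZ : (\int[Q]_w ((Z w)%:R)%:E = al%:E)%E.
Proof.
have [al0|] := ltP 0 al; first exact: poisson_rv_mean.
rewrite le_eqVlt ltNge al_ge0 orbF => /eqP al0.
by rewrite (poisson_rv_mean0 ZP al0) al0.
Qed.

Let E1P := law_mean_functional mX EX.
Let E2P := law_mean_functional mZ EZ.

Let gapZ : 0 < al -> forall j, mean_gap al (law_mean Q Z) j = 0.
Proof.
move=> al0 j; apply/eqP; rewrite -eqe -(mean_gapE (G := 0%E) mZ EZ)//.
by rewrite adde0 (poisson_rv_gap ZP).
Qed.

Let gap_le_real b : B = b%:E ->
  forall J, \sum_(j < J) mean_gap al (law_mean P X) j <= b.
Proof. by move=> Bb J; rewrite -lee_fin -sumEFin -Bb. Qed.

Let lg_ind (S : set nat) : lin_growth (fun i => (i \in S)%:R : R).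
Proof. exact: (@lin_growth_ind R (fun i => i \in S)). Qed.

Let law_set d (Om : measurableType d) (P' : probability Om R) (Y : Om -> nat)
    (EY : (\int[P']_w ((Y w)%:R)%:E = al%:E)%E) (mY : measurable_fun setT Y) S :
  P' (Y @^-1` S) = (law_mean P' Y (fun i => (i \in S)%:R))%:E.
Proof.
rewrite -(law_meanE mY EY (lg_ind S)).
have mS := measurable_nat_preimage S mY.
have := integral_indic P' measurableT mS; rewrite setIT => <-.
by apply: eq_integral => w _; congr (_%:E); rewrite indicE; congr (_%:R).
Qed.

Lemma min1inv_gt0 (a : R) : 0 <= a -> 0 < min1inv a.
Proof.
rewrite /min1inv le_eqVlt eq_sym; case: eqP => //= _ a0.
by rewrite lt_min ltr01 invr_gt0.
Qed.

Lemma dTV_le : (dTV P X Q Z <= (min1inv al)%:E * B)%E.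
Proof.
apply: ge_ereal_sup => _ [S _ <-].
rewrite (law_set EX mX) (law_set EZ mZ) -EFinB.
have rhs0 : (0 <= (min1inv al)%:E * B)%E.
  by rewrite mule_ge0// lee_fin ltW// min1inv_gt0.
have [al0|] := ltP 0 al; last first.
  move=> al_le0; have al0 : al = 0 by apply/eqP; rewrite eq_le al_le0.
  have E1P' : mean_functional 0 (law_mean P X) by move: E1P; rewrite al0.
  have E2P' : mean_functional 0 (law_mean Q Z) by move: E2P; rewrite al0.
  by rewrite (mean_degenerate E1P' (lg_ind S)) (mean_degenerate E2P' (lg_ind S)) subrr.
(* An infinite [B] makes the bound trivial, since [min1inv al] is positive. *)
case EB : B B0 => [b| |//] _; last first.
  by rewrite mulry gtr0_sg ?min1inv_gt0// mul1e leey.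
rewrite -EFinM lee_fin; apply: le_trans (ler_norm _) _.
rewrite /min1inv gt_eqF//.
apply: (mean_dist_ind al0 E1P E2P gap_ge0 (gap_le_real EB) (gapZ al0)).
  by move=> i; case: (_ \in _); rewrite /= ?lexx ?ler01.
exact: (archi_boundP (addr_ge0 al_ge0 ler01)).
Qed.

Lemma dW_le : (dW P X Q Z <= (3 * min1inv (Num.sqrt al))%:E * B)%E.
Proof.
apply: ge_ereal_sup => _ [g gL <-].
have lg := lin_growth_lip gL.
rewrite !unlock /= (law_meanE mX EX lg) (law_meanE mZ EZ lg) -EFinB abse_EFin.
have m0 : 0 < 3 * min1inv (Num.sqrt al) by rewrite mulr_gt0// min1inv_gt0// sqrtr_ge0.
have rhs0 : (0 <= (3 * min1inv (Num.sqrt al))%:E * B)%E.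
  by rewrite mule_ge0// lee_fin ltW.
have [al0|] := ltP 0 al; last first.
  move=> al_le0; have al0 : al = 0 by apply/eqP; rewrite eq_le al_le0.
  have E1P' : mean_functional 0 (law_mean P X) by move: E1P; rewrite al0.
  have E2P' : mean_functional 0 (law_mean Q Z) by move: E2P; rewrite al0.
  by rewrite (mean_degenerate E1P' lg) (mean_degenerate E2P' lg) subrr normr0.
case EB : B B0 => [b| |//] _; last first.
  by rewrite mulry gtr0_sg// mul1e leey.
rewrite -EFinM lee_fin /min1inv gt_eqF ?sqrtr_gt0//.
apply: (mean_dist_lip al0 E1P E2P gap_ge0 (gap_le_real EB) (gapZ al0)) => //.
exact: (archi_boundP al_ge0).
Qed.

End Distances.

Theorem mainTheorem7 (R : realType)
  (dT : measure_display) (T : measurableType dT) (mu : probability T R)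
  (mu_diffuse : diffuse mu)
  (k : nat) (k_gt0 : (0 < k)%N)
  (h : config T -> bool) (h_meas : measurable_fun (config_card (T := T) k) h)
  (s : R) (s_gt0 : 0 < s)
  (dO : measure_display) (Omega : measurableType dO) (P : probability Omega R)
  (eta : Omega -> config T) (eta_poisson : poisson_process P s mu eta)
  (dO' : measure_display) (Omega' : measurableType dO')
  (Q : probability Omega' R) (Z : Omega' -> nat) :
  let F : config T -> nat := subset_count k h in
  let lambda : {finite_measure set T -> \bar R} :=
    mscale (NngNum (ltW s_gt0)) mu in
  let alpha : R := fine ('E_P[fun w => (F (eta w))%:R]) in
  poisson_rv Q Z alpha ->
  (dTV P (F \o eta) Q Z
     <= (min1inv alpha)%:E * (gamma k h lambda * (k`!%:R^-1)%:E))%E /\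
  (dW P (F \o eta) Q Z
     <= (3 * min1inv (Num.sqrt alpha))%:E
        * (gamma k h lambda * (k`!%:R^-1)%:E))%E.
Proof.
move=> F lambda alpha ZP; have [A [mA A0 Adiag]] := mu_diffuse.
have mF : measurable_fun setT (F \o eta) := measurable_statistic h_meas eta_poisson.
have EF := statistic_mean s_gt0 Adiag mA A0 h_meas eta_poisson k_gt0.
(* [statistic_mean] also shows that the expectation is finite, so [fine] does not alter it. *)
have aE : alpha = k`!%:R^-1 * kernel_mass mu s_gt0 A k h.
  by rewrite /alpha unlock [X in fine X]EF.
have a0 : 0 <= alpha by rewrite aE mulr_ge0// fine_ge0.
rewrite -/F -aE in EF.
have gapE j : gap_mass mu s_gt0 A k h j =
    (mean_gap alpha (law_mean P (F \o eta)) j)%:E.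
  apply: (mean_gapE mF EF); first exact: gap_mass_ge0.
  by have := statistic_gap s_gt0 Adiag mA A0 h_meas eta_poisson k_gt0 j; rewrite -aE.
have gap0 j : 0 <= mean_gap alpha (law_mean P (F \o eta)) j.
  by rewrite -lee_fin -gapE gap_mass_ge0.
have gapB J : (\sum_(j < J) (mean_gap alpha (law_mean P (F \o eta)) j)%:E <=
    gamma k h lambda * (k`!%:R^-1)%:E)%E.
  under eq_bigr do rewrite -gapE.
  exact: (gap_mass_sum s_gt0 Adiag mA A0 h_meas eta_poisson k_gt0 J).
have B0 : (0 <= gamma k h lambda * (k`!%:R^-1)%:E)%E.
  by have := gapB 0%N; rewrite big_ord0.
split; first exact: (dTV_le mF a0 EF ZP B0 gap0 gapB).
exact: (dW_le mF a0 EF ZP B0 gap0 gapB).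
Qed.
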